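(* For any $\Lambda>0$ there exists $\delta>0$ such that the following holds: if $\varepsilon\in C(\mathbb{R}^2)$ is a positive $\mathbb{Z}^2$-periodic function with $|\varepsilon(x)-1|<\delta$ for all $x\in\mathbb{R}^2$, then for any $0\le\lambda\le\Lambda$ the partial differential equation $$-\Delta E=\lambda\varepsilon E$$ has a bounded nonzero solution in $\mathbb{R}^2$.
   Context: Since $\varepsilon$ is only assumed continuous, solutions $E:\mathbb{R}^2\to\mathbb{C}$ are understood in the sense of distributions. *)

(* Defs.v *)
From HB Require Import structures.
From mathcomp Require Import all_boot all_order all_algebra.
From mathcomp Require Import complex.
From mathcomp Require Import all_classical all_reals all_analysis.

Set Implicit Arguments.
Unset Strict Implicit.
Unset Printing Implicit Defensive.

Import Order.TTheory GRing.Theory Num.Theory.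
Import numFieldNormedType.Exports.

Local Open Scope classical_set_scope.
Local Open Scope ring_scope.
Local Open Scope complex_scope.

(* The plane is R * R with the product topology; complex-valued functions on it
   have values in R[i] and are differentiated and integrated componentwise. *)

Notation plane_measure R :=
  (@lebesgue_measure R \x @lebesgue_measure R)%E (only parsing).

Definition re_part (R : realType) (f : R * R -> R[i]) (x : R * R) : R :=
  complex.Re (f x).

Definition im_part (R : realType) (f : R * R -> R[i]) (x : R * R) : R :=
  complex.Im (f x).

Definition basis_vector (R : realType) (j : 'I_2) : R * R :=
  if j == ord0 then (1, 0) else (0, 1).

Definition partial (R : realType) (j : 'I_2) (f : R * R -> R) : R * R -> R :=
  fun x => 'D_(basis_vector R j) f x.

Definition iter_partial (R : realType) (s : seq 'I_2) (f : R * R -> R) :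
    R * R -> R :=
  foldr (@partial R) f s.

(* C^oo: all iterated partial derivatives exist and are continuous. *)
Definition smooth (R : realType) (f : R * R -> R) : Prop :=
  forall s : seq 'I_2,
    continuous (iter_partial s f) /\
    forall (j : 'I_2) (x : R * R),
      derivable (iter_partial s f) x (basis_vector R j).

Definition laplacian (R : realType) (f : R * R -> R) (x : R * R) : R :=
  \sum_(j < 2) partial j (partial j f) x.

Definition claplacian (R : realType) (f : R * R -> R[i]) (x : R * R) : R[i] :=
  laplacian (re_part f) x +i* laplacian (im_part f) x.

Definition cintegral (R : realType) (f : R * R -> R[i]) : R[i] :=
  Rintegral (plane_measure R) setT (re_part f) +i*
  Rintegral (plane_measure R) setT (im_part f).

Definition test_function (R : realType) (phi : R * R -> R[i]) : Prop :=
  [/\ smooth (re_part phi), smooth (im_part phi) &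
      compact (closure [set x | phi x != 0])].

Definition clocally_integrable (R : realType) (f : R * R -> R[i]) : Prop :=
  forall K : set (R * R), compact K ->
    (plane_measure R).-integrable K (EFin \o re_part f) /\
    (plane_measure R).-integrable K (EFin \o im_part f).

(* E solves - Delta E = lambda eps E in the sense of distributions, that is, as
   continuous linear functionals on the complex-valued test functions. *)
Definition distributional_solution (R : realType) (eps : R * R -> R)
    (lambda : R) (E : R * R -> R[i]) : Prop :=
  clocally_integrable E /\
  forall phi : R * R -> R[i], test_function phi ->
    - cintegral (fun x => E x * claplacian phi x) =
    cintegral (fun x => lambda%:C * (eps x)%:C * E x * phi x).

Definition cbounded (R : realType) (E : R * R -> R[i]) : Prop :=
  exists M : R, forall x : R * R, `|E x| <= M%:C.

(* As a distribution: a function vanishing almost everywhere is zero. *)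
Definition nonzero (R : realType) (E : R * R -> R[i]) : Prop :=
  ~ {ae (plane_measure R), forall x : R * R, E x = 0}.

Definition Z2_periodic (R : realType) (f : R * R -> R) : Prop :=
  forall (x : R * R) (m n : int), f (x.1 + m%:~R, x.2 + n%:~R) = f x.

(* Main.v *)
(** Finite differences and Bloch's theorem. On the grid of mesh h = 1/N, with N
    odd, quasi-periodic functions with quasimomentum k have N^2 Fourier
    coefficients, on which minus the five-point Laplacian acts diagonally,
    while multiplication by [lambda * eps] is unitarily equivalent to a
    diagonal matrix whose entries differ from lambda by at most lambda * delta.
    For a generic k of norm sqrt lambda the only mode of energy close to lambda
    is the zero mode, and its energy crosses lambda as k is rescaled. Hence the
    real determinant of the Hermitian difference changes sign, and for some k
    the discrete equation has a nonzero solution. In dimension two the inverse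
    of the symbol is square summable over the modes, so the Fourier
    coefficients of these solutions are uniformly summable; the solutions are
    thus uniformly bounded and equicontinuous, and a limit along an
    ultrafilter, uniform on compact sets, is a bounded nonzero weak solution by
    summation by parts. Compactness of the interval [0, Lambda] makes delta
    independent of lambda. *)
Require Import Defs.
From mathcomp Require Import all_boot all_order all_algebra.
From mathcomp Require Import complex.
From mathcomp Require Import all_classical all_reals all_analysis.
From mathcomp Require Import measurable_realfun zify ring lra.
Import Order.TTheory GRing.Theory Num.Theory.
Import numFieldNormedType.Exports.
Local Open Scope classical_set_scope.
Local Open Scope ring_scope.

Set Implicit Arguments.
Unset Strict Implicit.
Unset Printing Implicit Defensive.

(** * Complex modulus and unitary kernels *)

(** Fixing [lambda] and moving the quasimomentum turns a spectral question into a sign change of one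
    real function. All modes but the zero mode must lie on the same side of [lambda] at both ends of
    the path, at a distance exceeding the size [lambda * delta] of the perturbation. This excludes
    the Bragg lines, where another mode [k + 2 pi m] has the same energy as [k]. The opposite signs
    at the two ends survive the perturbation because neither end matrix becomes singular while the
    perturbation is switched on. The gap found at a positive [lambda] degenerates as [lambda] tends
    to 0, since the energy of the zero mode cannot be negative. Small [lambda] are therefore treated
    by an explicit path with gap [lambda / 2], which shrinks at the same rate as the perturbation
    and keeps [delta] away from 0. The limit does not vanish because the [N^2] grid values in a
    period cell have mean square one, so that some point of a fixed compact square carries modulus
    at least one. *)

Notation cabs := Normc.normc.
Local Notation "z ^*" := (conjc z) : ring_scope.
Local Notation "x %:C" := (real_complex _ x) : ring_scope.

Section ComplexModulus.
Variable R : realType.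
Implicit Types (z w : R[i]%C) (x : R).

Lemma cabsE z : `|z| = (cabs z)%:C.
Proof. by case: z. Qed.

Lemma cabs_ge0 z : 0 <= cabs z.
Proof. by case: z => a b; exact: sqrtr_ge0. Qed.

Lemma cabs_sqr z : cabs z ^+ 2 = complex.Re z ^+ 2 + complex.Im z ^+ 2.
Proof. by case: z => a b /=; rewrite sqr_sqrtr// addr_ge0// sqr_ge0. Qed.

Lemma cabs_sqrC z : (cabs z ^+ 2)%:C = z * z^*.
Proof. by rewrite rmorphXn/= -cabsE sqr_normc. Qed.

Lemma conjcM z w : (z * w)^* = z^* * w^*.
Proof. exact: rmorphM. Qed.

Lemma conjcB z w : (z - w)^* = z^* - w^*.
Proof. exact: rmorphB. Qed.

Lemma conjcMn z n : (z *+ n)^* = z^* *+ n.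
Proof. exact: rmorphMn. Qed.

Lemma cabs_real x : cabs x%:C = `|x|.
Proof. by rewrite /= expr0n addr0 sqrtr_sqr. Qed.

Lemma cabs_Re z : `|complex.Re z| <= cabs z.
Proof. by rewrite -lecR -cabsE; exact: normc_ge_Re. Qed.

Lemma cabs_Im z : `|complex.Im z| <= cabs z.
Proof.
by case: z => a b /=; rewrite -sqrtr_sqr ler_wsqrtr// lerDr sqr_ge0.
Qed.

Lemma cabs_le_ReIm z : cabs z <= `|complex.Re z| + `|complex.Im z|.
Proof.
rewrite -(@ler_pXn2r _ 2)// ?nnegrE ?addr_ge0 ?cabs_ge0//.
rewrite cabs_sqr sqrrD !real_normK ?num_real// -addrA lerD2l lerDr.
by rewrite mulrn_wge0// mulr_ge0.
Qed.

Lemma cabs_sum (I : Type) (r : seq I) (P : pred I) (F : I -> R[i]%C) :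
  cabs (\sum_(i <- r | P i) F i) <= \sum_(i <- r | P i) cabs (F i).
Proof.
rewrite -lecR -cabsE rmorph_sum/=; apply: le_trans (ler_norm_sum _ _ _) _.
by rewrite le_eqVlt; apply/orP; left; apply/eqP; apply: eq_bigr => i _; rewrite cabsE.
Qed.

End ComplexModulus.

Section UnitaryKernel.
Variables (R : realType) (T : finType).
Local Notation C := (R[i]%C).

Lemma parseval (T' : finType) (u : T -> T' -> C) (c : T -> C) :
  (forall n m, \sum_x u n x * (u m x)^* = (n == m)%:R) ->
  \sum_x cabs (\sum_n c n * u n x) ^+ 2 = \sum_n cabs (c n) ^+ 2.
Proof.
move=> hu; apply: (@complexI R); rewrite !rmorph_sum/=.
under eq_bigr do rewrite cabs_sqrC rmorph_sum/= big_distrlr/=.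
rewrite exchange_big/=; apply: eq_bigr => n _; rewrite exchange_big/=.
rewrite (bigD1 n)//= [X in _ + X]big1 => [|m mn].
  rewrite addr0 cabs_sqrC.
  under eq_bigr do rewrite rmorphM mulrACA.
  by rewrite -mulr_sumr hu eqxx mulr1.
under eq_bigr do rewrite rmorphM mulrACA.
by rewrite -mulr_sumr hu eq_sym (negbTE mn) mulr0.
Qed.

Lemma parseval_conj (T' : finType) (u : T -> T' -> C) (f : T' -> C) :
  (forall x y, \sum_n u n x * (u n y)^* = (x == y)%:R) ->
  \sum_n cabs (\sum_x f x * (u n x)^*) ^+ 2 = \sum_x cabs (f x) ^+ 2.
Proof.
move=> hu; apply: complexI; rewrite !rmorph_sum/=.
under eq_bigr do rewrite cabs_sqrC rmorph_sum/= big_distrlr/=.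
rewrite exchange_big/=; apply: eq_bigr => x _; rewrite exchange_big/=.
have e y : \sum_n (f x * (u n x)^*) * (f y * (u n y)^*)^* =
    f x * (f y)^* * (y == x)%:R.
  rewrite -hu mulr_sumr; apply: eq_bigr => n _.
  by rewrite conjcM conjcK; ring.
rewrite (bigD1 x)//= [X in _ + X]big1 => [|y yx]; rewrite e.
  by rewrite eqxx mulr1 addr0 cabs_sqrC.
by rewrite (negbTE yx) mulr0.
Qed.

Lemma det0_kernel (a : T -> T -> C) :
  \det (\matrix_(i, j < #|T|) a (enum_val i) (enum_val j)) = 0 ->
  exists c : T -> C, (exists n, c n != 0) /\ forall m, \sum_n c n * a n m = 0.
Proof.
move/eqP/det0P => [v v0 va]; exists (fun n => v 0 (enum_rank n)); split.
  case/rV0Pn: v0 => j vj; exists (enum_val j); by rewrite enum_valK.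
move=> m; have /rowP/(_ (enum_rank m)) := va; rewrite !mxE => va0; rewrite -[RHS]va0.
rewrite (reindex_onto enum_val enum_rank)/=; last by move=> i _; rewrite enum_rankK.
under eq_bigl do rewrite enum_valK eqxx.
by apply: eq_bigr => i _; rewrite mxE enum_valK enum_rankK.
Qed.

Lemma det_diag_kernel (d : T -> C) :
  \det (\matrix_(i, j < #|T|) (d (enum_val i) *+ (enum_val i == enum_val j))) =
  \prod_n d n.
Proof.
rewrite (_ : matrix_of_fun _ _ = diag_mx (\row_i d (enum_val i))); last first.
  by apply/matrixP => i j; rewrite !mxE (inj_eq enum_val_inj).
rewrite det_diag [RHS](reindex_onto enum_val enum_rank)/=; last first.
  by move=> i _; rewrite enum_rankK.
under [RHS]eq_bigl do rewrite enum_valK eqxx.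
by apply: eq_bigr => i _; rewrite mxE.
Qed.

(** Transposition conjugates a Hermitian matrix and preserves its determinant. *)
Lemma det_hermitian_Im (n : nat) (A : 'M[C]_n) :
  (forall i j, A j i = (A i j)^*) -> complex.Im (\det A) = 0.
Proof.
move=> hA; have : \det A = (\det A)^*.
  rewrite -[RHS]det_map_mx -det_tr; congr (\det _); apply/matrixP => i j.
  by rewrite !mxE hA.
case: (\det A) => x y /= [] h; lra.
Qed.

End UnitaryKernel.

(** * Continuity of complex determinants and sign changes *)

Section ComplexContinuity.
Variables (R : realType).
Local Notation C := (R[i]%C).

(** Componentwise, since the intermediate value theorem will be applied to the real part of a
    determinant. *)
Definition ccontinuous (S : topologicalType) (f : S -> C) :=
  continuous (fun x => complex.Re (f x)) /\ continuous (fun x => complex.Im (f x)).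

Lemma ccontinuous_cst (S : topologicalType) (z : C) :
  ccontinuous (fun _ : S => z).
Proof. by split=> x; exact: cvg_cst. Qed.

Lemma ccontinuous_real (S : topologicalType) (f : S -> R) :
  continuous f -> ccontinuous (fun x => (f x)%:C).
Proof. by move=> cf; split => //= x; exact: cvg_cst. Qed.

Lemma ccontinuousD (S : topologicalType) (f g : S -> C) :
  ccontinuous f -> ccontinuous g -> ccontinuous (fun x => f x + g x).
Proof.
move=> [f1 f2] [g1 g2]; split => x.
  rewrite (_ : (fun _ => _) = (fun x => complex.Re (f x) + complex.Re (g x))).
    by apply: cvgD; [exact: f1|exact: g1].
  by apply/funext => y; case: (f y) (g y) => a b [].
rewrite (_ : (fun _ => _) = (fun x => complex.Im (f x) + complex.Im (g x))).
  by apply: cvgD; [exact: f2|exact: g2].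
by apply/funext => y; case: (f y) (g y) => a b [].
Qed.

Lemma ccontinuousM (S : topologicalType) (f g : S -> C) :
  ccontinuous f -> ccontinuous g -> ccontinuous (fun x => f x * g x).
Proof.
move=> [f1 f2] [g1 g2]; split => x.
  rewrite (_ : (fun _ => _) = (fun x => complex.Re (f x) * complex.Re (g x) -
      complex.Im (f x) * complex.Im (g x))).
    apply: cvgB; apply: cvgM; [exact: f1|exact: g1|exact: f2|exact: g2].
  by apply/funext => y; case: (f y) (g y) => a b [].
rewrite (_ : (fun _ => _) = (fun x => complex.Re (f x) * complex.Im (g x) +
    complex.Im (f x) * complex.Re (g x))).
  apply: cvgD; apply: cvgM; [exact: f1|exact: g2|exact: f2|exact: g1].
by apply/funext => y; case: (f y) (g y) => a b [].
Qed.

Lemma ccontinuous_sum (S : topologicalType) (I : Type) (r : seq I) (P : pred I)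
    (F : I -> S -> C) : (forall i, ccontinuous (F i)) ->
  ccontinuous (fun x => \sum_(i <- r | P i) F i x).
Proof.
move=> cF; elim: r => [|i r IH].
  by under eq_fun do rewrite big_nil; exact: ccontinuous_cst.
under eq_fun do rewrite big_cons; case: (P i) => //.
exact: ccontinuousD.
Qed.

Lemma ccontinuous_prod (S : topologicalType) (I : Type) (r : seq I) (P : pred I)
    (F : I -> S -> C) : (forall i, ccontinuous (F i)) ->
  ccontinuous (fun x => \prod_(i <- r | P i) F i x).
Proof.
move=> cF; elim: r => [|i r IH].
  by under eq_fun do rewrite big_nil; exact: ccontinuous_cst.
under eq_fun do rewrite big_cons; case: (P i) => //.
exact: ccontinuousM.
Qed.

Lemma ccontinuous_det (S : topologicalType) (n : nat) (A : S -> 'M[C]_n) :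
  (forall i j, ccontinuous (fun x => A x i j)) ->
  ccontinuous (fun x => \det (A x)).
Proof.
move=> cA; rewrite /determinant; apply: ccontinuous_sum => s.
apply: ccontinuousM; first exact: ccontinuous_cst.
by apply: ccontinuous_prod => i; exact: cA.
Qed.

Lemma continuous_same_sign (g : R -> R) : continuous g ->
  (forall t, 0 <= t <= 1 -> g t != 0) -> 0 < g 0 * g 1.
Proof.
move=> cg g0; rewrite ltNge; apply/negP => h.
have /(IVT (@ler01 R)) : {within `[0, 1], continuous g}.
  exact: continuous_subspaceT.
move=> /(_ 0); case.
- rewrite ge_min le_max; case: (leP (g 0) 0) => [h0|h0] /=.
    case: (leP 0 (g 1)) => [//|h1]; rewrite ?orbT//.
    have g00 : g 0 != 0 by apply: g0; rewrite lexx ler01.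
    have : 0 < g 0 * g 1 by rewrite nmulr_rgt0// lt_neqAle g00.
    by rewrite ltNge h.
  by rewrite (ltW h0) /= andbT; move: h; rewrite pmulr_rle0.
- by move=> c; rewrite in_itv/= => /g0/eqP.
Qed.

End ComplexContinuity.

(* A Hermitian determinant is real, and it does not vanish while the diagonal
   dominates the perturbation; so its sign changes along [t] when the sign of
   the product of the diagonal entries does. *)
Lemma eigenvector_crossing (R : realType) (T : finType) (u : T -> T -> R[i]%C)
    (W : T -> R) (lam v : R) (w : R -> T -> R) :
  (forall n m, \sum_x u n x * (u m x)^* = (n == m)%:R) ->
  (forall x y, \sum_n u n x * (u n y)^* = (x == y)%:R) ->
  (forall x, `|W x - lam| <= v) ->
  (forall n, continuous (fun t => w t n)) ->
  (forall n, v < `|w 0 n - lam|) -> (forall n, v < `|w 1 n - lam|) ->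
  (\prod_n (w 0 n - lam)) * (\prod_n (w 1 n - lam)) < 0 ->
  exists t, 0 <= t <= 1 /\ exists c : T -> R[i]%C,
    (exists n, c n != 0) /\
    forall m, c m * (w t m)%:C =
      \sum_x (W x)%:C * (\sum_n c n * u n x) * (u m x)^*.
Proof.
move=> hu hu' hW cw hw0 hw1 hprod.
pose H n m := \sum_x u n x * (W x - lam)%:C * (u m x)^*.
(* The parameter [s] switches the perturbation on: the matrix is diagonal at [s = 0], and at [s = 1]
   its kernel equation is the claim shifted by [lam]. *)
pose a s t n m : R[i]%C := ((w t n - lam)%:C *+ (n == m)) - s%:C * H n m.
pose A s t := \matrix_(i, j < #|T|) a s t (enum_val i) (enum_val j).
have HH n m : H m n = (H n m)^*.
  rewrite /H rmorph_sum/=; apply: eq_bigr => x _.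
  by rewrite !conjcM conjcK conjc_real; ring.
have imA s t : complex.Im (\det (A s t)) = 0.
  apply: det_hermitian_Im => i j; rewrite !mxE /a conjcB conjcMn conjcM.
  by rewrite !conjc_real -HH eq_sym; case: eqP => [->//|].
have sumH c m : \sum_n c n * H n m =
    \sum_x (W x - lam)%:C * (\sum_n c n * u n x) * (u m x)^*.
  rewrite /H; under eq_bigr do rewrite mulr_sumr.
  rewrite exchange_big/=; apply: eq_bigr => x _.
  by rewrite mulr_sumr mulr_suml; apply: eq_bigr => n _; ring.
have suma s t c m : \sum_n c n * a s t n m =
    c m * (w t m - lam)%:C - s%:C * \sum_n c n * H n m.
  rewrite /a; under eq_bigr do rewrite mulrBr.
  rewrite sumrB mulr_sumr (bigD1 m)//= eqxx mulr1n big1 ?addr0.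
    by congr (_ - _); apply: eq_bigr => n _; ring.
  by move=> n /negbTE ->; rewrite mulr0n mulr0.
(* By the two Parseval identities a kernel vector [c] satisfies
   [sum |c|^2 |w - lam|^2 <= v^2 sum |c|^2], which contradicts [v < |w - lam|] at a nonzero
   coefficient. *)
have nonsing s t : 0 <= s <= 1 -> (forall n, v < `|w t n - lam|) ->
    complex.Re (\det (A s t)) != 0.
  move=> /andP[s0 s1] hw; apply/eqP => dre.
  have : \det (A s t) = 0 by move: dre (imA s t); case: (\det _) => x y /= -> ->.
  move=> /det0_kernel [c [[n0 cn0]]] hc.
  have v0 : 0 <= v by apply: le_trans (hW n0).
  have e1 m : cabs (c m) ^+ 2 * `|w t m - lam| ^+ 2 =
      s ^+ 2 * cabs (\sum_x (W x - lam)%:C * (\sum_n c n * u n x) * (u m x)^*) ^+ 2.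
    have := hc m; rewrite suma sumH => /eqP; rewrite subr_eq0 => /eqP h.
    move: (congr1 (fun z => cabs z ^+ 2) h).
    by rewrite !Normc.normcM !exprMn !cabs_real (ger0_norm s0).
  have e2 : \sum_m cabs (c m) ^+ 2 * `|w t m - lam| ^+ 2 =
      s ^+ 2 * \sum_x cabs ((W x - lam)%:C * (\sum_n c n * u n x)) ^+ 2.
    rewrite -(parseval_conj _ hu') mulr_sumr.
    by apply: eq_bigr => m _; rewrite e1.
  have : \sum_m cabs (c m) ^+ 2 * `|w t m - lam| ^+ 2 <=
      v ^+ 2 * \sum_m cabs (c m) ^+ 2.
    rewrite e2 -(parseval c hu) mulr_sumr mulr_sumr; apply: ler_sum => x _.
    rewrite Normc.normcM exprMn cabs_real mulrA; apply: ler_wpM2r; first exact: sqr_ge0.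
    rewrite -exprMn; apply: lerXn2r; rewrite ?nnegrE ?mulr_ge0//.
    by apply: le_trans (hW x); rewrite ler_piMl.
  rewrite mulr_sumr -subr_ge0 -sumrB => hle.
  have hterm m : 0 <= cabs (c m) ^+ 2 * `|w t m - lam| ^+ 2 -
      v ^+ 2 * cabs (c m) ^+ 2.
    rewrite mulrC -mulrBl mulr_ge0 ?sqr_ge0// subr_ge0.
    by rewrite lerXn2r ?nnegrE// ltW.
  have : \sum_m (cabs (c m) ^+ 2 * `|w t m - lam| ^+ 2 -
      v ^+ 2 * cabs (c m) ^+ 2) = 0.
    apply/eqP; rewrite eq_le sumr_ge0// andbT -oppr_ge0 -sumrN.
    by under eq_bigr do rewrite opprB.
  move/eqP; rewrite psumr_eq0// => /allP/(_ n0); rewrite mem_index_enum => /(_ isT).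
  rewrite /= mulrC -mulrBl mulf_eq0; case/orP.
    rewrite subr_eq0 eqrXn2// => /eqP h.
    by have := hw n0; rewrite h ltxx.
  by rewrite sqrf_eq0 => /eqP/Normc.eq0_normc/eqP; apply/negP.
have cadet (f : R -> R) (g : R -> R) : continuous f -> continuous g ->
    continuous (fun r => complex.Re (\det (A (f r) (g r)))).
  move=> cf cg; apply: (ccontinuous_det (A := fun r => A (f r) (g r)) _).1 => i j.
  rewrite /A /a; under eq_fun do rewrite mxE.
  apply: ccontinuousD.
    case: (enum_val i == enum_val j) => /=; last exact: ccontinuous_cst.
    apply: ccontinuous_real => r; apply: cvgB; last exact: cvg_cst.
    by apply: (@continuous_comp _ _ _ g (fun t => w t _)); [exact: cg|exact: cw].
  under eq_fun do rewrite -mulNr -rmorphN.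
  apply: ccontinuousM; last exact: ccontinuous_cst.
  by apply: ccontinuous_real => r; apply: cvgN; exact: cf.
have det0 t : \det (A 0 t) = (\prod_n (w t n - lam))%:C.
  rewrite rmorph_prod/= -det_diag_kernel; congr (\det _).
  by apply/matrixP => i j; rewrite !mxE /a mul0r subr0.
have leg0 : 0 < complex.Re (\det (A 0 0)) * complex.Re (\det (A 1 0)).
  apply: (continuous_same_sign (g := fun r => complex.Re (\det (A r 0)))).
    by apply: cadet => r; [exact: cvg_id|exact: cvg_cst].
  by move=> r r01; exact: nonsing.
have leg1 : 0 < complex.Re (\det (A 0 1)) * complex.Re (\det (A 1 1)).
  apply: (continuous_same_sign (g := fun r => complex.Re (\det (A r 1)))).
    by apply: cadet => r; [exact: cvg_id|exact: cvg_cst].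
  by move=> r r01; exact: nonsing.
have [t [t01 dt]] : exists t, 0 <= t <= 1 /\ complex.Re (\det (A 1 t)) = 0.
  apply: contrapT => hn.
  (* Without a zero on the side [s = 1], the determinant keeps its sign along three sides of the
     square in [(s, t)], so its values at the corners [(0, 0)] and [(0, 1)] agree in sign, against
     [hprod]. *)
  have leg : 0 < complex.Re (\det (A 1 0)) * complex.Re (\det (A 1 1)).
    apply: (continuous_same_sign (g := fun r => complex.Re (\det (A 1 r)))).
      by apply: cadet => r; [exact: cvg_cst|exact: cvg_id].
    by move=> r r01; apply/eqP => h; apply: hn; exists r.
  move: hprod leg leg0 leg1; rewrite !det0 /=.
  set p := \prod_n _; set q := \prod_n _; set y := complex.Re _; set z := complex.Re _.
  move=> pq yz py qz.
  have := mulr_gt0 (mulr_gt0 py qz) yz.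
  rewrite (_ : _ * _ = (p * q) * ((y * z) ^+ 2)); last ring.
  by apply/negP; rewrite -leNgt mulr_le0_ge0 ?sqr_ge0 ?ltW.
exists t; split => //.
have : \det (A 1 t) = 0 by move: dt (imA 1 t); case: (\det _) => x y /= -> ->.
move=> /det0_kernel [c [c0 hc]]; exists c; split => // m.
have := hc m; rewrite suma sumH mul1r => /eqP; rewrite subr_eq0 => /eqP h.
(* Undoing the shift: by orthonormality, the constant multiplier [lam] acts on the coefficients as
   [lam] times the identity. *)
have -> : w t m = (w t m - lam) + lam by rewrite subrK.
rewrite rmorphD mulrDr h.
under [RHS]eq_bigr do rewrite -[W _](subrK lam) rmorphD !mulrDl.
rewrite big_split/=; congr (_ + _).
under eq_bigr do rewrite -mulrA; rewrite -mulr_sumr mulrC; congr (_ * _).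
under eq_bigr do rewrite mulr_suml; rewrite exchange_big/=.
rewrite (bigD1 m)//= [X in _ + X]big1 ?addr0 => [|n nm].
  by under eq_bigr do rewrite -mulrA; rewrite -mulr_sumr hu eqxx mulr1.
by under eq_bigr do rewrite -mulrA; rewrite -mulr_sumr hu (negbTE nm) mulr0.
Qed.

(** * Ultralimits and uniform continuity *)

Section Ultralimits.
Variables (R : realType) (U : set_system nat).
Hypothesis UU : UltraFilter U.

(** Compactness of [[-A, A]] yields a cluster point, and an ultrafilter converges to each of its
    cluster points. *)
Lemma ultra_bounded_cvg (g : nat -> R) (A : R) :
  (forall m, `|g m| <= A) -> exists l : R, g @ U --> l.
Proof.
move=> gA; have := @segment_compact R (- A) A.
move=> /(_ (g @ U)); case.
  apply: (@filterS _ U _ setT) => [m _|]; last exact: filterT.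
  by rewrite /= in_itv/= -ler_norml.
move=> l [_ cl]; exists l => B lB.
have [//|UnB] := @in_ultra_setVsetC _ _ (g @^-1` B) UU.
by have [x [/= nBx Bx]] := cl (~` B) B UnB lB.
Qed.

(** Arzela-Ascoli without subsequences: one ultrafilter gives the pointwise limits at all points at
    once, equicontinuity passes to the limit, and a covering argument makes the convergence uniform
    on compact sets. *)
Lemma ultra_equicontinuous (V : normedModType R) (g : nat -> V -> R) (A : R) :
  (forall m x, `|g m x| <= A) ->
  (forall eta, 0 < eta -> exists2 rho, 0 < rho &
    forall m x y, `|x - y| < rho -> `|g m x - g m y| <= eta) ->
  exists e : V -> R, [/\ forall x, `|e x| <= A, continuous e &
    forall (K : set V) eta, compact K -> 0 < eta ->
      \forall m \near U, forall x, K x -> `|g m x - e x| <= eta].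
Proof.
move=> gA gE.
have /choice[e he] : forall x, exists l : R, (fun m => g m x) @ U --> l.
  by move=> x; apply: ultra_bounded_cvg => m; exact: gA.
have nearU x eta : 0 < eta -> \forall m \near U, `|g m x - e x| <= eta.
  move=> eta0; have /cvgrPdist_le/(_ _ eta0) := he x.
  by apply: filterS => m; rewrite distrC.
have eE eta rho : 0 < eta ->
    (forall m x y, `|x - y| < rho -> `|g m x - g m y| <= eta) ->
    forall x y, `|x - y| < rho -> `|e x - e y| <= 3 * eta.
  move=> eta0 h x y xy.
  have [m [mx my]] := filter_ex (filterI (nearU x _ eta0) (nearU y _ eta0)).
  have := h m _ _ xy; move: mx my; rewrite !ler_norml.
  by move=> /andP[? ?] /andP[? ?] /andP[? ?]; apply/andP; split; lra.
exists e; split.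
- move=> x; apply/ler_addgt0Pr => eta eta0.
  have [m mx] := filter_ex (nearU x _ eta0); have := gA m x; move: mx.
  by rewrite !ler_norml => /andP[? ?] /andP[? ?]; apply/andP; split; lra.
- move=> x; apply/cvgrPdist_le => eta eta0.
  have eta3 : 0 < eta / 3 by lra.
  have [rho rho0 h] := gE _ eta3.
  near=> y; have -> : eta = 3 * (eta / 3) by lra.
  apply: (eE _ rho) => //; near: y; exact: cvgr_dist_lt.
- move=> K eta /compact_near_coveringP cK eta0.
  (* One sixth each for [g m] between [x] and [y] and for [g m - e] at [x], and three sixths for [e]
     between [x] and [y]. *)
  have eta6 : 0 < eta / 6 by lra.
  have [rho rho0 h] := gE _ eta6.
  apply: (cK _ U (fun m x => `|g m x - e x| <= eta)) => x Kx.
  near=> y m => /=.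
  have xy : `|x - y| < rho by near: y; exact: cvgr_dist_lt.
  have := h m _ _ xy; have := eE _ _ eta6 h _ _ xy.
  have : `|g m x - e x| <= eta / 6 by near: m; exact: nearU.
  rewrite !ler_norml.
  by move=> /andP[? ?] /andP[? ?] /andP[? ?]; apply/andP; split; lra.
Unshelve. all: by end_near.
Qed.

End Ultralimits.

(** Only [x] is confined to [K]: intermediate points of finite differences taken near the edge of a
    square may fall outside it. *)
Lemma uniform_continuity_compact (R : realType) (V : normedModType R) (f : V -> R)
    (K : set V) (eta : R) : compact K -> continuous f -> 0 < eta ->
  exists2 rho, 0 < rho & forall x y, K x -> `|x - y| < rho -> `|f x - f y| <= eta.
Proof.
move=> /compact_near_coveringP cK cf eta0.
have eta2 : 0 < eta / 2 by lra.
have : \forall rho \near 0^'+, K `<=` (fun x =>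
    forall y, `|x - y| < rho -> `|f x - f y| <= eta).
  apply: (cK _ (0^'+) (fun (rho : R) x =>
    forall y, `|x - y| < rho -> `|f x - f y| <= eta)) => x Kx.
  have /cvgrPdist_le/(_ _ eta2) := cf x.
  move=> /nbhs_ballP[r /= r0 hr].
  have r2 : 0 < r / 2 by lra.
  near=> y rho => /= z yz.
  have xy : `|x - y| < r / 2 by near: y; exact: cvgr_dist_lt.
  have rr : rho < r / 2 by near: rho; exact: nbhs_right_lt.
  have hy : `|f x - f y| <= eta / 2.
    by apply: hr; rewrite -ball_normE /ball_/=; lra.
  have hz : `|f x - f z| <= eta / 2.
    apply: hr; rewrite -ball_normE /ball_/=.
    by rewrite (le_lt_trans (ler_distD y _ _))//; lra.
  move: hy hz; rewrite !ler_norml => /andP[? ?] /andP[? ?].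
  by apply/andP; split; lra.
move=> h; have [rho [rho0 hr]] := filter_ex (filterI (nbhs_right_gt 0) h).
by exists rho => // x y Kx; exact: hr.
Unshelve. all: by end_near.
Qed.

(** The mean value theorem twice: for [f (t + h) - f t] on [[x - h, x]], then for [f1] on an
    interval of length [h] starting at the point found. *)
Lemma second_difference (R : realType) (f f1 f2 : R -> R) (x h : R) :
  (forall t, is_derive t (1 : R) f (f1 t)) -> (forall t, is_derive t (1 : R) f1 (f2 t)) ->
  0 < h ->
  exists2 c, `|c| <= h & f (x + h) + f (x - h) - 2 * f x = h ^+ 2 * f2 (x + c).
Proof.
move=> d1 d2 h0.
have cf (g g' : R -> R) : (forall t, is_derive t (1 : R) g (g' t)) -> continuous g.
  move=> dg t; apply: differentiable_continuous; apply/derivable1_diffP.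
  exact: (@ex_derive _ _ _ _ _ _ _ (dg t)).
have dF t : is_derive t (1 : R) (fun t => f (t + h) - f t) (f1 (t + h) - f1 t).
  apply: is_deriveB.
  rewrite -[f1 (t + h)]mul1r.
  have := @is_derive1_comp _ f (fun t => t + h) t (f1 (t + h)) 1.
  rewrite mulr1 mul1r; apply.
  by rewrite -[X in is_derive _ _ _ X]addr0; apply: is_deriveD.
have [||c] := @MVT R _ _ (x - h) x _ (fun t _ => dF t).
- by rewrite ltrBlDr ltrDl.
- exact/continuous_subspaceT/(cf _ _ dF).
rewrite in_itv/= => /andP[c1 c2]; rewrite subrK (_ : x - (x - h) = h); last lra.
move=> E1.
have [||d] := @MVT R f1 f2 c (c + h) _ (fun t _ => d2 t).
- by rewrite ltrDl.
- exact/continuous_subspaceT/(cf _ _ d2).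
rewrite in_itv/= => /andP[e1 e2]; rewrite (_ : c + h - c = h); last lra.
move=> E2.
exists (d - x); first by rewrite ler_norml; apply/andP; split; lra.
rewrite (_ : x + (d - x) = d); last lra.
move: E1; rewrite E2; lra.
Qed.

(** * Lebesgue measure on the plane *)

Section PlaneMeasure.
Variable R : realType.
Local Notation plane := (measurableTypeR R * measurableTypeR R)%type.
Local Notation mu := (plane_measure R).

(** Measurability refers to the product sigma-algebra. An open set belongs to it as a countable
    union of open rational boxes, enumerated through [pickle]. *)
Lemma open_plane_measurable (O : set (R * R)) : open O ->
  measurable (O : set plane).
Proof.
move=> oO.
pose box (q : rat * rat * (rat * rat)) : set plane :=
  `]ratr q.1.1, ratr q.1.2[ `*` `]ratr q.2.1, ratr q.2.2[.
pose F k : set plane := if unpickle k is Some q then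
  (if `[< box q `<=` O >] then box q else set0) else set0.
have -> : O = \bigcup_k F k.
  apply/seteqP; split => [[x y] Oxy|x [k _]]; last first.
    by rewrite /F; case: unpickle => // q; case: ifPn => // /asboolP; apply.
  have : nbhs (x, y) O by exact: open_nbhs_nbhs.
  move=> /nbhs_ballP[r /= r0 hr].
  have [q1 ] := @rat_in_itvoo R (x - r) x ltac:(lra).
  have [q2 ] := @rat_in_itvoo R x (x + r) ltac:(lra).
  have [q3 ] := @rat_in_itvoo R (y - r) y ltac:(lra).
  have [q4 ] := @rat_in_itvoo R y (y + r) ltac:(lra).
  rewrite !in_itv/= => /andP[? ?] /andP[? ?] /andP[? ?] /andP[? ?].
  exists (pickle (q1, q2, (q3, q4))); [exact: I|rewrite /F pickleK].
  case: ifPn => [_|/asboolP].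
    by split; rewrite /= in_itv/=; apply/andP.
  case => -[a b] [/=]; rewrite !in_itv/= => /andP[? ?] /andP[? ?].
  by apply: hr; split; rewrite /ball/= ltr_norml; apply/andP; split; lra.
apply: bigcupT_measurable => k; rewrite /F; case: unpickle => // q.
by case: ifP => // _; apply: measurableX; exact: measurable_itv.
Qed.

Lemma continuous_plane_measurable (f : R * R -> R) (D : set plane) :
  measurable D -> continuous f -> measurable_fun D (f : plane -> R).
Proof.
move=> mD /continuousP cf; apply: (measurability _ (RGenOpens.measurableE R)).
move=> _ [_ [a [b ->] <-]]; apply: measurableI => //.
by apply: open_plane_measurable; apply: cf; exact: interval_open.
Qed.

Lemma measure_box (a b c d : R) : a <= b -> c <= d ->
  mu (`[a, b[ `*` `[c, d[) = ((b - a) * (d - c))%:E.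
Proof.
move=> ab cd; rewrite product_measure1E; [|exact: measurable_itv|exact: measurable_itv].
have e (u v : R) : u <= v -> lebesgue_measure (`[u, v[ : set R) = (v - u)%:E.
  move=> uv; rewrite lebesgue_measure_itv/= lte_fin.
  by case: ltgtP uv => // -> _; rewrite subrr.
by rewrite EFinM; congr (_ * _)%E; exact: e.
Qed.

Lemma measurable_box (a b c d : R) :
  measurable (`[a, b[ `*` `[c, d[ : set plane).
Proof. by apply: measurableX; exact: measurable_itv. Qed.

Lemma integrable_box (a b c d k : R) :
  mu.-integrable setT (fun x => (k * \1_(`[a, b[ `*` `[c, d[) x)%:E).
Proof.
under eq_fun do rewrite EFinM; apply: integrableZl => //.
apply/integrableP; split.
  by apply/measurable_EFinP; apply: measurable_indic; exact: measurable_box.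
under eq_integral do rewrite gee0_abs ?lee_fin//.
rewrite integral_indic//; last exact: measurable_box.
rewrite setIT.
have [ab|ba] := leP a b; last first.
  by rewrite set_itv_ge ?bnd_simp -?leNgt 1?ltW// set0X measure0.
have [cd|dc] := leP c d; last first.
  by rewrite [X in _ `*` X]set_itv_ge ?bnd_simp -?leNgt 1?ltW// setX0 measure0.
by have := ltry ((b - a) * (d - c)); rewrite -(measure_box ab cd).
Qed.

Lemma Rintegral_box (a b c d k : R) : a <= b -> c <= d ->
  Rintegral mu setT (fun x => k * \1_(`[a, b[ `*` `[c, d[) x) =
  k * ((b - a) * (d - c)).
Proof.
move=> ab cd; rewrite RintegralZl//; last first.
  have := integrable_box a b c d 1; apply: eq_integrable => // x _ /=.
  by rewrite mul1r.
congr (_ * _); rewrite /Rintegral integral_indic//; last exact: measurable_box.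
by rewrite setIT; exact: (congr1 fine (measure_box ab cd)).
Qed.

Lemma Rintegral_sum (I : Type) (s : seq I) (F : I -> plane -> R) :
  (forall i, mu.-integrable setT (EFin \o F i)) ->
  Rintegral mu setT (fun x => \sum_(i <- s) F i x) =
  \sum_(i <- s) Rintegral mu setT (F i).
Proof.
move=> iF; elim: s => [|i s IH].
  by rewrite big_nil; under eq_fun do rewrite big_nil; rewrite Rintegral_cst// mul0r.
rewrite big_cons -IH; under eq_fun do rewrite big_cons.
rewrite RintegralD//.
have := @integrable_sum _ _ _ mu setT measurableT _ s xpredT _ (fun i _ => iF i).
by apply: eq_integrable => // x _ /=; rewrite sumEFin.
Qed.

(* A null set has empty interior, since a box has positive measure. *)
Lemma continuous_ae0 (f : R * R -> R) : continuous f ->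
  {ae mu, forall x, f x = 0} -> forall x, f x = 0.
Proof.
move=> cf [N [mN N0 fN]] [x y]; apply: contrapT => fxy.
have fx0 : 0 < `|f (x, y)| by rewrite normr_gt0; exact/eqP.
have /cvgrPdist_lt/(_ _ fx0) := cf (x, y).
move=> /nbhs_ballP[r /= r0 hr].
have sub : `[x, x + r[ `*` `[y, y + r[ `<=` N.
  move=> [a b] [/=]; rewrite !in_itv/= => /andP[? ?] /andP[? ?].
  apply: fN => /= f0; have /= := hr (a, b).
  rewrite f0 subr0 ltxx => h; apply: notF; apply: h.
  by split; rewrite /ball/= ltr_norml; apply/andP; split; lra.
have h : ((((x + r) - x) * ((y + r) - y))%:E <= 0)%E.
  rewrite -(@measure_box x (x + r) y (y + r)) ?lerDl ?(ltW r0)// -N0.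
  by apply: le_measure => //; rewrite inE//; exact: measurable_box.
have := mulr_gt0 r0 r0; move: h; rewrite lee_fin; nra.
Qed.

End PlaneMeasure.

(** * Riemann sums *)

Section RiemannSums.
Variable R : realType.
Local Notation plane := (measurableTypeR R * measurableTypeR R)%type.
Local Notation mu := (plane_measure R).

Definition node (B N i : nat) : R := - B%:R + i%:R / N%:R.

Definition riemann (B N : nat) (f : R * R -> R) : R :=
  \sum_(i < 2 * B * N) \sum_(j < 2 * B * N) f (node B N i, node B N j) / N%:R ^+ 2.

(** The square is half-open because the half-open grid cells tile exactly this set. *)
Definition supported (B : nat) (f : R * R -> R) : Prop :=
  forall x y, ~~ ((- B%:R <= x < B%:R) && (- B%:R <= y < B%:R)) -> f (x, y) = 0.

Lemma node_exists (B N : nat) (z : R) : (0 < N)%N -> - B%:R <= z < B%:R ->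
  exists i : 'I_(2 * B * N), node B N i <= z < node B N i + N%:R^-1.
Proof.
move=> N0 /andP[z1 z2]; have N0' : 0 < N%:R :> R by rewrite ltr0n.
have zN : 0 <= (z + B%:R) * N%:R by apply: mulr_ge0 => //; lra.
have /andP[t1 t2] := truncn_itv zN.
have tn : (Num.truncn ((z + B%:R) * N%:R) < 2 * B * N)%N.
  rewrite -(ltr_nat R); apply: le_lt_trans t1 _.
  by rewrite !natrM ltr_pM2r//; lra.
exists (Ordinal tn); rewrite /node /=; apply/andP; split.
  have := t1; rewrite -ler_pdivrMr; lra.
have := t2; rewrite -ltr_pdivlMr// -addn1 natrD mulrDl mul1r; lra.
Qed.

Lemma node_unique (B N i j : nat) (z : R) : (0 < N)%N ->
  node B N i <= z < node B N i + N%:R^-1 ->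
  node B N j <= z < node B N j + N%:R^-1 -> i = j.
Proof.
move=> N0; have N0' : 0 < N%:R^-1 :> R by rewrite invr_gt0 ltr0n.
rewrite /node => /andP[i1 i2] /andP[j1 j2].
have h (a b : nat) : - B%:R + a%:R / N%:R <= z -> z < - B%:R + b%:R / N%:R + N%:R^-1 ->
    (a <= b)%N.
  move=> h1 h2; rewrite -ltnS -(ltr_nat R) -addn1 natrD -(ltr_pM2r N0').
  rewrite mulrDl mul1r; lra.
by apply/eqP; rewrite eqn_leq !h.
Qed.

Lemma node_bound (B N : nat) (i : 'I_(2 * B * N)) : (0 < N)%N ->
  - B%:R <= node B N i < B%:R.
Proof.
move=> N0; have N0' : 0 < N%:R :> R by rewrite ltr0n.
rewrite /node lerDl divr_ge0//= addrC ltrBlDr ltr_pdivrMr//.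
by have := ltn_ord i; rewrite -(ltr_nat R) !natrM; lra.
Qed.

(** The Riemann sum is the integral of the step function [s] that takes on each cell the value of
    [f] at its lower left corner. The difference [f - s] is dominated by [eta] times the indicator
    of the square, which gives both integrability and the error bound. *)
Lemma riemann_error (B N : nat) (f : R * R -> R) (rho eta : R) :
  (0 < N)%N -> continuous f -> supported B f ->
  (forall x y, - B%:R <= x.1 <= B%:R -> - B%:R <= x.2 <= B%:R ->
    `|x - y| < rho -> `|f x - f y| <= eta) ->
  N%:R^-1 < rho -> 0 <= eta ->
  mu.-integrable setT (EFin \o f) /\
  `|Rintegral mu setT f - riemann B N f| <= eta * (2 * B%:R) ^+ 2.
Proof.
move=> N0 cf sf mf Nrho eta0.
have N0' : 0 < N%:R^-1 :> R by rewrite invr_gt0 ltr0n.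
set n := (2 * B * N)%N.
pose C (p : 'I_n * 'I_n) : set plane :=
  `[node B N p.1, node B N p.1 + N%:R^-1[ `*`
  `[node B N p.2, node B N p.2 + N%:R^-1[.
pose v (p : 'I_n * 'I_n) := f (node B N p.1, node B N p.2).
pose s (z : plane) := \sum_p v p * \1_(C p) z.
pose D : set plane := `[- B%:R, B%:R[ `*` `[- B%:R, B%:R[.
have CE p z : C p z <-> (node B N p.1 <= z.1 < node B N p.1 + N%:R^-1) /\
    (node B N p.2 <= z.2 < node B N p.2 + N%:R^-1).
  by rewrite /C /= !in_itv.
have fs z : `|f z - s z| <= eta * \1_D z.
  have [Dz|nDz] := pselect (D z).
    rewrite indicE mem_set// mulr1; case: z Dz => x y [/=]; rewrite !in_itv/=.
    move=> bx by'.
    have [i hi] := node_exists N0 bx; have [j hj] := node_exists N0 by'.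
    rewrite /s (bigD1 (i, j))//= big1 => [|p pij].
      rewrite addr0 indicE mem_set; last exact/CE.
      rewrite mulr1 distrC; apply: mf => /=.
      - by case/andP: (node_bound i N0) => -> /ltW ->.
      - by case/andP: (node_bound j N0) => -> /ltW ->.
      apply: le_lt_trans Nrho; rewrite prod_normE/= ge_max.
      by rewrite !ler_norml; case/andP: hi => ? ?; case/andP: hj => ? ?;
        apply/andP; split; apply/andP; split; lra.
    rewrite indicE memNset ?mulr0// => /CE/= [h1 h2]; move/eqP: pij; apply.
    have e1 := node_unique N0 hi h1; have e2 := node_unique N0 hj h2.
    by case: p e1 e2 {h1 h2} => a b /= /val_inj -> /val_inj ->.
  rewrite indicE memNset// mulr0.
  have -> : f z = 0.
    case: z nDz => x y nD; apply: sf; apply/negP => /andP[h1 h2]; apply: nD.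
    by split; rewrite /= in_itv.
  rewrite /s big1 ?subr0 ?normr0// => p _; rewrite indicE memNset ?mulr0//.
  move=> /CE[h1 h2]; apply: nDz.
  have b (i : 'I_n) : node B N i + N%:R^-1 <= B%:R.
    have := ltn_ord i; rewrite -(ler_nat R) -addn1 natrD -(ler_pM2r N0').
    by rewrite mulrDl mul1r /n !natrM mulfK ?pnatr_eq0 -?lt0n// /node; lra.
  have := b p.1; have := b p.2; have /andP[? ?] := node_bound p.1 N0.
  have /andP[? ?] := node_bound p.2 N0; move: h1 h2 => /andP[? ?] /andP[? ?] ? ?.
  by split; rewrite /= in_itv/=; apply/andP; split; lra.
have is_ p : mu.-integrable setT (EFin \o (fun z => v p * \1_(C p) z)).
  exact: integrable_box.
have intS : mu.-integrable setT (EFin \o s).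
  have := @integrable_sum _ _ _ mu setT measurableT _ (index_enum _) xpredT _
    (fun i _ => is_ i).
  by apply: eq_integrable => // x _ /=; rewrite sumEFin.
have mfT : measurable_fun setT (f : plane -> R) by exact: continuous_plane_measurable.
have intfs : mu.-integrable setT (EFin \o (fun z => f z - s z)).
  apply: (le_integrable measurableT _ _ (integrable_box (- B%:R) B%:R (- B%:R) B%:R eta)).
    apply/measurable_EFinP; apply: measurable_funB => //.
    by have /integrableP[/measurable_EFinP] := intS.
  by move=> z _; rewrite lee_fin [leRHS]ger0_norm ?mulr_ge0//; exact: fs.
have intf : mu.-integrable setT (EFin \o f).
  have := integrableD measurableT intfs intS.
  by apply: eq_integrable => // z _; rewrite /= -EFinD subrK.
split => //.
have -> : riemann B N f = Rintegral mu setT s.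
  rewrite Rintegral_sum// /riemann pair_bigA/=; apply: eq_bigr => p _.
  rewrite Rintegral_box ?lerDl ?(ltW N0')//; congr (_ * _).
  by rewrite -exprVn; ring.
rewrite -RintegralB//.
apply: le_trans (le_normr_Rintegral measurableT intfs) _.
have -> : eta * (2 * B%:R) ^+ 2 = Rintegral mu setT (fun z => eta * \1_D z).
  by rewrite Rintegral_box ?ge0_cp//; ring.
apply: le_Rintegral => //.
- by have := integrable_abse intfs; apply: eq_integrable.
- exact: integrable_box.
Qed.

Lemma compact_square (B : R) :
  compact [set x : R * R | - B <= x.1 <= B /\ - B <= x.2 <= B].
Proof.
have := compact_setX (@segment_compact R (- B) B) (@segment_compact R (- B) B).
congr compact; apply/seteqP; split => -[x y] /=; by rewrite !in_itv.
Qed.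

Lemma riemann_cvg (B : nat) (f : R * R -> R) : continuous f -> supported B f ->
  mu.-integrable setT (EFin \o f) /\
  (forall eta, 0 < eta -> \forall N \near \oo,
    `|Rintegral mu setT f - riemann B N f| <= eta).
Proof.
(* The added 1 keeps [c] positive when [B = 0]. *)
move=> cf sf; pose c : R := (2 * B%:R) ^+ 2 + 1.
have c0 : 0 < c by rewrite ltr_wpDl// sqr_ge0.
have main eta : 0 < eta -> \forall N \near \oo, mu.-integrable setT (EFin \o f) /\
    `|Rintegral mu setT f - riemann B N f| <= eta.
  move=> eta0; have eta0' : 0 < eta / c by rewrite divr_gt0.
  have [rho rho0 h] := uniform_continuity_compact (@compact_square B%:R) cf eta0'.
  near=> N.
  have N0 : (0 < N)%N by near: N; exact: nbhs_infty_gt.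
  have Nr : N%:R^-1 < rho.
    rewrite invf_plt ?posrE ?ltr0n//; near: N; exact: nbhs_infty_gtr.
  have [//|i le] := @riemann_error B N f rho (eta / c) N0 cf sf _ Nr (ltW eta0').
    by move=> x y h1 h2; exact: h.
  split => //; apply: le_trans le _.
  rewrite -mulrA -[leRHS]mulr1 ler_pM2l// mulrC ler_pdivrMr// mul1r /c.
  by rewrite lerDl.
split.
  by have [N [? _]] := filter_ex (main 1 ltr01).
by move=> eta /main; apply: filterS => N [].
Unshelve. all: by end_near.
Qed.

End RiemannSums.

(** * The discrete Laplacian *)

Section DiscreteLaplacian.
Variable R : realType.
Implicit Types (f g p : R * R -> R) (z v : R * R).

Lemma is_derive_line f v z (t : R) : (forall z, derivable f z v) ->
  is_derive t (1 : R) (fun t => f (z + t *: v)) ('D_v f (z + t *: v)).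
Proof.
move=> df.
have E : (fun h : R => h^-1 *: (f (z + (h *: (1 : R) + t) *: v) - f (z + t *: v))) =
    (fun h : R => h^-1 *: (f (h *: v + (z + t *: v)) - f (z + t *: v))).
  apply/funext => h; congr (_ *: (f _ - _)).
  by rewrite scalerDl addrCA /GRing.scale/= mulr1.
split; first by have := df (z + t *: v); rewrite /derivable -E.
exact: (congr1 (fun F : R -> R => lim (F @ 0^')) E).
Qed.

Lemma derive_near0 f v z : (\forall x \near z, f x = 0) -> 'D_v f z = 0.
Proof.
move=> f0; transitivity ('D_v (cst (0 : R)) z); last exact: derive_cst.
by apply: near_eq_derive; exact: f0.
Qed.

Lemma partial_supported f (j : 'I_2) (r : R) :
  (forall z, r < `|z| -> f z = 0) -> forall z, r < `|z| -> partial j f z = 0.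
Proof.
move=> f0 z rz; apply: derive_near0; near=> x; apply: f0.
near: x; have /cvgr_gt := @norm_continuous R (R * R)%type z; exact.
Unshelve. all: by end_near.
Qed.

Definition dlap (h : R) f z : R :=
  f (z.1 + h, z.2) + f (z.1 - h, z.2) + f (z.1, z.2 + h) + f (z.1, z.2 - h) - 4 * f z.

Lemma dlap_mean p z h : smooth p -> 0 < h ->
  exists z1 z2, [/\ `|z - z1| <= h, `|z - z2| <= h & dlap h p z =
    h ^+ 2 * (partial ord0 (partial ord0 p) z1 +
              partial (lift ord0 ord0) (partial (lift ord0 ord0) p) z2)].
Proof.
move=> sp h0.
have key (j : 'I_2) : exists2 c : R, `|c| <= h &
    p (z + h *: basis_vector R j) + p (z - h *: basis_vector R j) - 2 * p z =
    h ^+ 2 * partial j (partial j p) (z + c *: basis_vector R j).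
  have [||c hc] := @second_difference R (fun t => p (z + t *: basis_vector R j))
      (fun t => partial j p (z + t *: basis_vector R j))
      (fun t => partial j (partial j p) (z + t *: basis_vector R j)) 0 h _ _ h0.
  - by move=> t; apply: is_derive_line => x; exact: (sp [::]).2.
  - by move=> t; apply: is_derive_line => x; exact: (sp [:: j]).2.
  by rewrite !add0r scaleNr scale0r addr0 => e; exists c.
have [c hc e1] := key ord0; have [d hd e2] := key (lift ord0 ord0).
have b1 : basis_vector R ord0 = (1, 0) by [].
have b2 : basis_vector R (lift ord0 ord0) = (0, 1) by [].
exists (z + c *: basis_vector R ord0), (z + d *: basis_vector R (lift ord0 ord0)).
have nb (e : R) (j : 'I_2) : `|e| <= h -> `|z - (z + e *: basis_vector R j)| <= h.
  move=> eh; rewrite opprD addrA subrr sub0r normrN normrZ.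
  apply: le_trans eh; rewrite ler_piMr// /basis_vector; case: ifP => _.
    by rewrite prod_normE/= normr1 normr0 ge_max lexx ler01.
  by rewrite prod_normE/= normr1 normr0 ge_max lexx ler01.
split; [exact: nb|exact: nb|].
have t1 (t : R) : z + t *: basis_vector R ord0 = (z.1 + t, z.2).
  by rewrite b1; congr (_, _); rewrite /= ?scaler0 ?addr0// /GRing.scale/= mulr1.
have t2 (t : R) : z + t *: basis_vector R (lift ord0 ord0) = (z.1, z.2 + t).
  by rewrite b2; congr (_, _); rewrite /= ?scaler0 ?addr0// /GRing.scale/= mulr1.
rewrite mulrDr -e1 -e2 -!(scaleNr h) !t1 !t2 /dlap.
by move: (p (_, _)) (p (_, _)) (p (_, _)) (p (_, _)) (p z) => ? ? ? ? ?; ring.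
Qed.

Lemma sum_by_parts (u v : nat -> R) (n : nat) :
  (* index [i.+1] stands for the i-th node *)
  v 0%N = 0 -> v 1%N = 0 -> v n = 0 -> v n.+1 = 0 ->
  \sum_(i < n) u i.+1 * (v i.+2 + v i - 2 * v i.+1) =
  \sum_(i < n) (u i.+2 + u i - 2 * u i.+1) * v i.+1.
Proof.
move=> v0 v1 vn vn1; apply/eqP; rewrite -subr_eq0 -sumrB.
(* A discrete Wronskian: up to sign, its increments are the differences of the two summands, so the
   sum telescopes to boundary terms. *)
pose a i := u i.+1 * v i - u i * v i.+1.
have -> : \sum_(i < n) (u i.+1 * (v i.+2 + v i - 2 * v i.+1) -
    (u i.+2 + u i - 2 * u i.+1) * v i.+1) = \sum_(i < n) - (a i.+1 - a i).
  by apply: eq_bigr => i _; rewrite /a; ring.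
rewrite sumrN -(big_mkord xpredT (fun i => a i.+1 - a i)) telescope_sumr//.
by rewrite /a v0 v1 vn vn1 !mulr0 !subrr oppr0.
Qed.

Lemma nodeS (B N i : nat) : node R B N i.+1 = node R B N i + N%:R^-1.
Proof. by rewrite /node -addn1 natrD mulrDl mul1r addrA. Qed.

(** As the mesh is at most 1, [p] vanishes at the first and last nodes of every grid line and at
    their outer neighbours, so no boundary term survives in either direction. *)
Lemma riemann_by_parts (B N : nat) g p : (0 < B)%N -> (0 < N)%N ->
  (forall z, B%:R - 1 <= `|z| -> p z = 0) ->
  riemann B N (fun z => g z * dlap N%:R^-1 p z) =
  riemann B N (fun z => dlap N%:R^-1 g z * p z).
Proof.
move=> B0 N0 p0; set h : R := N%:R^-1.
have h0 : 0 < h by rewrite invr_gt0 ltr0n.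
have h1 : h <= 1 by rewrite invf_le1 ?ltr0n// ler1n.
pose tau (i : nat) := node R B N i - h.
have tau1 i : tau i.+1 = node R B N i by rewrite /tau nodeS addrK.
have tauS i : tau i.+1 = tau i + h by rewrite /tau nodeS addrAC.
have B1 : (1 : R) <= B%:R by rewrite ler1n.
have px x y : B%:R - 1 <= `|x| -> p (x, y) = 0 /\ p (y, x) = 0.
  by move=> hx; split; apply: p0; rewrite prod_normE/= le_max hx ?orbT.
have e0 y : p (tau 0%N, y) = 0 /\ p (y, tau 0%N) = 0.
  apply: px; rewrite /tau /node mul0r addr0 -opprD normrN ger0_norm; lra.
have e1 y : p (tau 1%N, y) = 0 /\ p (y, tau 1%N) = 0.
  apply: px; rewrite tau1 /node mul0r addr0 normrN ger0_norm; lra.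
have nn : node R B N (2 * B * N) = B%:R.
  rewrite /node !natrM mulfK ?pnatr_eq0 -?lt0n//; lra.
have en y : p (tau (2 * B * N)%N, y) = 0 /\ p (y, tau (2 * B * N)%N) = 0.
  apply: px; rewrite /tau nn ger0_norm; lra.
have en1 y : p (tau (2 * B * N).+1, y) = 0 /\ p (y, tau (2 * B * N).+1) = 0.
  apply: px; rewrite tau1 nn ger0_norm; lra.
pose dx f z := f (z.1 + h, z.2) + f (z.1 - h, z.2) - 2 * f z : R.
pose dy f z := f (z.1, z.2 + h) + f (z.1, z.2 - h) - 2 * f z : R.
have dE f z : dlap h f z = dx f z + dy f z by rewrite /dlap /dx /dy; ring.
have tauP i : tau i.+1 - h = tau i by rewrite tauS addrK.
have X : \sum_(i < 2 * B * N) \sum_(j < 2 * B * N)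
      g (tau i.+1, tau j.+1) * dx p (tau i.+1, tau j.+1) =
    \sum_(i < 2 * B * N) \sum_(j < 2 * B * N)
      dx g (tau i.+1, tau j.+1) * p (tau i.+1, tau j.+1).
  rewrite exchange_big/= [RHS]exchange_big/=; apply: eq_bigr => j _.
  have := @sum_by_parts (fun i => g (tau i, tau j.+1)) (fun i => p (tau i, tau j.+1))
    _ (e0 _).1 (e1 _).1 (en _).1 (en1 _).1.
  rewrite /dx /= => H; under eq_bigr do rewrite tauP -tauS.
  by under [RHS]eq_bigr do rewrite tauP -tauS; exact: H.
have Y : \sum_(i < 2 * B * N) \sum_(j < 2 * B * N)
      g (tau i.+1, tau j.+1) * dy p (tau i.+1, tau j.+1) =
    \sum_(i < 2 * B * N) \sum_(j < 2 * B * N)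
      dy g (tau i.+1, tau j.+1) * p (tau i.+1, tau j.+1).
  apply: eq_bigr => i _.
  have := @sum_by_parts (fun j => g (tau i.+1, tau j)) (fun j => p (tau i.+1, tau j))
    _ (e0 _).2 (e1 _).2 (en _).2 (en1 _).2.
  rewrite /dy /= => H; under eq_bigr do rewrite tauP -tauS.
  by under [RHS]eq_bigr do rewrite tauP -tauS; exact: H.
rewrite /riemann; under eq_bigr do rewrite -mulr_suml.
rewrite -mulr_suml; under [RHS]eq_bigr do rewrite -mulr_suml.
rewrite -[RHS]mulr_suml; congr (_ / _).
under eq_bigr do under eq_bigr do rewrite dE mulrDr -!tau1.
under [RHS]eq_bigr do under eq_bigr do rewrite dE mulrDl -!tau1.
under eq_bigr do rewrite big_split/=.
under [RHS]eq_bigr do rewrite big_split/=.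
by rewrite big_split/= [RHS]big_split/= X Y.
Qed.

End DiscreteLaplacian.

(** * Passage to the limit *)

Section WeakLimit.
Variable R : realType.
Local Notation mu := (plane_measure R).
Implicit Types (f g p e : R * R -> R).

Lemma laplacianE f z : laplacian f z = partial ord0 (partial ord0 f) z +
  partial (lift ord0 ord0) (partial (lift ord0 ord0) f) z.
Proof.
by rewrite /laplacian big_ord_recl big_ord_recl big_ord0 [X in _ + X]addr0.
Qed.

Lemma smooth_laplacian_continuous p : smooth p -> continuous (laplacian p).
Proof.
move=> sp z; rewrite (_ : laplacian p = fun z => partial ord0 (partial ord0 p) z +
  partial (lift ord0 ord0) (partial (lift ord0 ord0) p) z); last first.
  by apply/funext => w; exact: laplacianE.
apply: cvgD; first exact: (sp [:: ord0; ord0]).1.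
exact: (sp [:: lift ord0 ord0; lift ord0 ord0]).1.
Qed.

Lemma supported_norm (B : nat) (r : R) f : r < B%:R ->
  (forall z, r < `|z| -> f z = 0) -> supported B f.
Proof.
move=> rB f0 x y h; apply: f0; rewrite ltNge; apply: contra h => /=.
rewrite prod_normE/= ge_max !ler_norml => /andP[/andP[? ?] /andP[? ?]].
by apply/andP; split; apply/andP; split; lra.
Qed.

Lemma laplacian_supported (r : R) p : (forall z, r < `|z| -> p z = 0) ->
  forall z, r < `|z| -> laplacian p z = 0.
Proof.
move=> p0 z rz; rewrite laplacianE.
have h j : partial j (partial j p) z = 0.
  by apply: partial_supported rz => w rw; exact: partial_supported rw.
by rewrite !h [LHS]addr0.
Qed.

Lemma riemann_close (B N : nat) f g (eta : R) : (0 < N)%N ->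
  (forall z, `|z| <= B%:R -> `|f z - g z| <= eta) ->
  `|riemann B N f - riemann B N g| <= eta * (2 * B%:R) ^+ 2.
Proof.
move=> N0 fg; have N0' : N%:R != 0 :> R by rewrite pnatr_eq0 -lt0n.
rewrite /riemann -sumrB; apply: le_trans (ler_norm_sum _ _ _) _.
apply: (@le_trans _ _ (\sum_(i < 2 * B * N) \sum_(j < 2 * B * N) eta / N%:R ^+ 2)).
  apply: ler_sum => i _; rewrite -sumrB; apply: le_trans (ler_norm_sum _ _ _) _.
  apply: ler_sum => j _; rewrite -mulrBl normrM [`|_^-1|]ger0_norm; last first.
    by rewrite invr_ge0 exprn_ge0.
  rewrite ler_wpM2r ?invr_ge0 ?exprn_ge0//; apply: fg.
  have /andP[? ?] := node_bound R i N0; have /andP[? ?] := node_bound R j N0.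
  rewrite prod_normE/= ge_max !ler_norml.
  by apply/andP; split; apply/andP; split; lra.
rewrite !sumr_const !card_ord -mulrnA -[leLHS]mulr_natr !natrM le_eqVlt; apply/orP; left.
by apply/eqP; field.
Qed.

Lemma bounded_square f (B : R) : continuous f ->
  exists2 c, 0 <= c & forall z, `|z| <= B -> `|f z| <= c.
Proof.
move=> cf; have := continuous_compact (continuous_subspaceT cf) (@compact_square R B).
move=> /compact_bounded[M [Mr hM]]; exists (`|M| + 1) => // z zB.
apply: hM; first by rewrite (le_lt_trans (ler_norm _))// ltrDl.
exists z => //; move: zB; rewrite prod_normE/= ge_max !ler_norml.
by move=> /andP[].
Qed.

Lemma distD_le (et x1 x2 y1 y2 : R) : `|x1 - y1| <= et -> `|x2 - y2| <= et ->
  `|y1 + y2 - (x1 + x2)| <= et * 2.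
Proof. by rewrite !ler_norml => /andP[? ?] /andP[? ?]; apply/andP; split; lra. Qed.

Lemma approx_opp (et I1 I2 S1 S2 T d1 d2 : R) :
  `|I1 - S1| <= et -> `|I2 - S2| <= et ->
  `|- T - S1| <= d1 -> `|T - S2| <= d2 -> `|I1 + I2| <= et + et + d1 + d2.
Proof.
rewrite !ler_norml => /andP[? ?] /andP[? ?] /andP[? ?] /andP[? ?].
by apply/andP; split; lra.
Qed.

(** The discrete equation is known only at integer multiples of [1 / N m], which are exactly the
    sampling points of the Riemann sums. Summation by parts moves the difference operator to [p],
    where smoothness turns it into the Laplacian. *)
Lemma weak_limit (U : set_system nat) (g : nat -> R * R -> R) e (A : R)
    (N : nat -> nat) (kappa p : R * R -> R) (B : nat) :
  UltraFilter U -> \oo `<=` U -> (forall m, (m < N m)%N) ->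
  (forall m x, `|g m x| <= A) -> continuous e ->
  (forall (K : set (R * R)) eta, compact K -> 0 < eta ->
      \forall m \near U, forall x, K x -> `|g m x - e x| <= eta) ->
  continuous kappa ->
  (forall m (a b : int), let z := (a%:~R / (N m)%:R, b%:~R / (N m)%:R) in
     dlap (N m)%:R^-1 (g m) z = - ((N m)%:R^-1 ^+ 2 * (kappa z * g m z))) ->
  (0 < B)%N -> smooth p -> (forall z, B%:R - 1 <= `|z| -> p z = 0) ->
  Rintegral mu setT (fun z => e z * laplacian p z) =
  - Rintegral mu setT (fun z => kappa z * e z * p z).
Proof.
move=> UU ooU Nm gA ce ge ck geq B0 sp p0.
have A0 : 0 <= A by apply: le_trans (gA 0%N 0).
have cp : continuous p := (sp [::]).1.
have cl := smooth_laplacian_continuous sp.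
have c1 : continuous (fun z => e z * laplacian p z).
  by move=> z; apply: cvgM; [exact: ce|exact: cl].
have c2 : continuous (fun z => kappa z * e z * p z).
  by move=> z; apply: cvgM; [apply: cvgM; [exact: ck|exact: ce]|exact: cp].
have p0' z : B%:R - 1 < `|z| -> p z = 0 by move=> /ltW; exact: p0.
have B1 : B%:R - 1 < B%:R :> R by lra.
have s1 : supported B (fun z => e z * laplacian p z).
  by apply: supported_norm B1 _ => z h; rewrite (laplacian_supported p0')// mulr0.
have s2 : supported B (fun z => kappa z * e z * p z).
  by apply: supported_norm B1 _ => z h; rewrite p0'// mulr0.
have [C1 C10 hC1] := bounded_square B%:R cl.
have ckp : continuous (fun z => kappa z * p z).
  by move=> z; apply: cvgM; [exact: ck|exact: cp].
have [C2 C20 hC2] := bounded_square B%:R ckp.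
have [_ r1] := riemann_cvg c1 s1; have [_ r2] := riemann_cvg c2 s2.
apply/eqP; rewrite -subr_eq0 opprK -normr_le0; apply/ler_addgt0Pr => eta eta0.
rewrite add0r.
(* The 2 counts the two Riemann errors; per unit of area, [A * 2] comes from the discrete Laplacian
   of [p], while [C1] and [C2] come from replacing [g m] by [e] on either side. *)
pose c : R := 2 + (2 * B%:R) ^+ 2 * (A * 2 + C1 + C2).
have c0 : 0 < c.
  by rewrite ltr_wpDr// mulr_ge0 ?sqr_ge0// !addr_ge0// mulr_ge0.
pose et := eta / c; have et0 : 0 < et by rewrite divr_gt0.
have cpp (j : 'I_2) : continuous (partial j (partial j p)) := (sp [:: j; j]).1.
have [rho1 rho10 h1] := uniform_continuity_compact (@compact_square R B%:R) (cpp ord0) et0.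
have [rho2 rho20 h2] :=
  uniform_continuity_compact (@compact_square R B%:R) (cpp (lift ord0 ord0)) et0.
have n1 := ge _ _ (@compact_square R B%:R) et0.
(* Since [m < N m] and [U] refines the cofinite filter, what holds for all large mesh numbers holds
   for [N m] along [U]. *)
have Noo : forall P : set nat, (\forall n \near \oo, P n) -> \forall m \near U, P (N m).
  move=> P [k _ hk]; apply: ooU; exists k => // m /= km; apply: hk => /=.
  exact: leq_trans km (ltnW (Nm m)).
near U => m.
have N0 : (0 < N m)%N by exact: leq_ltn_trans (Nm m).
set h : R := (N m)%:R^-1; have h0 : 0 < h by rewrite invr_gt0 ltr0n.
have hr1 : h < rho1.
  rewrite invf_plt ?posrE ?ltr0n//; near: m.
  by apply: (Noo (fun n => rho1^-1 < n%:R)); exact: nbhs_infty_gtr.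
have hr2 : h < rho2.
  rewrite invf_plt ?posrE ?ltr0n//; near: m.
  by apply: (Noo (fun n => rho2^-1 < n%:R)); exact: nbhs_infty_gtr.
have i1 : `|Rintegral mu setT (fun z => e z * laplacian p z) -
    riemann B (N m) (fun z => e z * laplacian p z)| <= et.
  by near: m; exact: Noo (r1 _ et0).
have i2 : `|Rintegral mu setT (fun z => kappa z * e z * p z) -
    riemann B (N m) (fun z => kappa z * e z * p z)| <= et.
  by near: m; exact: Noo (r2 _ et0).
have gm z : `|z| <= B%:R -> `|g m z - e z| <= et.
  move=> zB; move: z zB; near: m; apply: filterS n1 => m hm z zB; apply: hm.
  by move: zB; rewrite prod_normE/= ge_max !ler_norml => /andP[].
have dl z : `|z| <= B%:R -> `|h ^- 2 * dlap h p z - laplacian p z| <= et * 2.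
  move=> zB; have [z1 [z2 [zz1 zz2 ->]]] := dlap_mean z sp h0.
  rewrite mulKf ?expf_neq0 ?gt_eqF// laplacianE.
  have sq : [set x : R * R | - B%:R <= x.1 <= B%:R /\ - B%:R <= x.2 <= B%:R] z.
    by move: zB; rewrite prod_normE/= ge_max !ler_norml => /andP[].
  apply: distD_le; [apply: h1 => //; exact: le_lt_trans hr1|].
  by apply: h2 => //; exact: le_lt_trans hr2.
have b1 : `|riemann B (N m) (fun z => g m z * (h ^- 2 * dlap h p z)) -
    riemann B (N m) (fun z => e z * laplacian p z)| <=
    (A * (et * 2) + et * C1) * (2 * B%:R) ^+ 2.
  apply: riemann_close => // z zB.
  rewrite (_ : _ - _ = g m z * (h ^- 2 * dlap h p z - laplacian p z) +
    (g m z - e z) * laplacian p z); last by ring.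
  apply: le_trans (ler_normD _ _) _; rewrite !normrM; apply: lerD; apply: ler_pM => //.
  - exact: dl.
  - exact: gm.
  - exact: hC1.
have b2 : `|riemann B (N m) (fun z => kappa z * g m z * p z) -
    riemann B (N m) (fun z => kappa z * e z * p z)| <=
    (et * C2) * (2 * B%:R) ^+ 2.
  apply: riemann_close => // z zB.
  rewrite (_ : _ - _ = (g m z - e z) * (kappa z * p z)); last by ring.
  rewrite normrM; apply: ler_pM => //; [exact: gm|exact: hC2].
have E : riemann B (N m) (fun z => g m z * (h ^- 2 * dlap h p z)) =
    - riemann B (N m) (fun z => kappa z * g m z * p z).
  have rZ (c' : R) f : riemann B (N m) (fun z => c' * f z) = c' * riemann B (N m) f.
    rewrite /riemann mulr_sumr; apply: eq_bigr => i _; rewrite mulr_sumr.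
    by apply: eq_bigr => j _; rewrite mulrA.
  transitivity (h ^- 2 * riemann B (N m) (fun z => g m z * dlap h p z)).
    by rewrite -rZ; congr riemann; apply/funext => z; rewrite mulrCA.
  rewrite riemann_by_parts// -mulN1r.
  transitivity (h ^- 2 * riemann B (N m) (fun z => - h ^+ 2 * (kappa z * g m z * p z))).
    congr (_ * _); rewrite /riemann; apply: eq_bigr => i _; apply: eq_bigr => j _.
    (* The corner [- B] is itself a multiple of the mesh, so the nodes are grid points and [geq]
       applies. *)
    have nodeE k : node R B (N m) k = ((k%:Z - (B * N m)%:Z)%:~R / (N m)%:R).
      rewrite /node intrB mulrBl -!pmulrn natrM mulfK ?pnatr_eq0 -?lt0n//.
      by rewrite addrC.
    by rewrite !nodeE (geq m) -/h; ring.
  by rewrite rZ mulrA mulrN mulVf ?expf_neq0 ?gt_eqF.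
rewrite E in b1.
have key : `|Rintegral mu setT (fun z => e z * laplacian p z) +
    Rintegral mu setT (fun z => kappa z * e z * p z)| <= et * c.
  apply: le_trans (approx_opp i1 i2 b1 b2) _.
  by rewrite /c le_eqVlt; apply/orP; left; apply/eqP; ring.
by rewrite (le_trans key)// /et divfK// gt_eqF.
Unshelve. all: by end_near.
Qed.

End WeakLimit.

(** * Bounded nonzero weak solutions as ultralimits *)

Section LimitSolution.
Variable R : realType.
Local Notation plane := (measurableTypeR R * measurableTypeR R)%type.
Local Notation mu := (plane_measure R).

Lemma norm_square (B : R) (x : R * R) :
  `|x| <= B -> [set x : R * R | - B <= x.1 <= B /\ - B <= x.2 <= B] x.
Proof. by rewrite prod_normE/= ge_max !ler_norml => /andP[]. Qed.

Lemma bounded_continuous_integrable (f : R * R -> R) (A : R) (K : set (R * R)) :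
  continuous f -> (forall x, `|f x| <= A) -> compact K ->
  mu.-integrable K (EFin \o f).
Proof.
move=> cf fA cK.
have mK : measurable (K : set plane).
  rewrite -[K]setCK; apply: measurableC; apply: open_plane_measurable.
  by apply: closed_openC; apply: compact_closed => //; exact: norm_hausdorff.
apply: measurable_bounded_integrable => //.
- have /compact_bounded[M [Mr hM]] := cK.
  have M1 : 0 <= `|M| + 1 by rewrite addr_ge0.
  have KM : K `<=` `[- (`|M| + 1), (`|M| + 1) + 1[ `*` `[- (`|M| + 1), (`|M| + 1) + 1[.
    move=> x Kx; have /norm_square[] : `|x| <= `|M| + 1.
      by apply: hM => //; rewrite (le_lt_trans (ler_norm _))// ltrDl.
    move=> /andP[? ?] /andP[? ?].
    by split; rewrite /= in_itv/=; apply/andP; split; lra.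
  apply: (@le_lt_trans _ _ (mu (`[- (`|M| + 1), (`|M| + 1) + 1[ `*`
      `[- (`|M| + 1), (`|M| + 1) + 1[))).
    by apply: le_measure => //; rewrite inE//; exact: measurable_box.
  by rewrite (@measure_box R) ?ltry//; lra.
- exact: continuous_plane_measurable.
- exists A; split; first exact: num_real.
  by move=> B AB x _ /=; apply: le_trans (ltW AB).
Qed.

Lemma RintegralB_opp (f1 f2 k1 k2 : plane -> R) :
  mu.-integrable setT (EFin \o f1) -> mu.-integrable setT (EFin \o f2) ->
  mu.-integrable setT (EFin \o k1) -> mu.-integrable setT (EFin \o k2) ->
  Rintegral mu setT f1 = - Rintegral mu setT k1 ->
  Rintegral mu setT f2 = - Rintegral mu setT k2 ->
  - Rintegral mu setT (fun x => f1 x - f2 x) =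
  Rintegral mu setT (fun x => k1 x - k2 x).
Proof.
move=> i1 i2 j1 j2 e1 e2; rewrite (RintegralB measurableT i1 i2).
by rewrite (RintegralB measurableT j1 j2) e1 e2 opprB opprK addrC.
Qed.

Lemma RintegralD_opp (f1 f2 k1 k2 : plane -> R) :
  mu.-integrable setT (EFin \o f1) -> mu.-integrable setT (EFin \o f2) ->
  mu.-integrable setT (EFin \o k1) -> mu.-integrable setT (EFin \o k2) ->
  Rintegral mu setT f1 = - Rintegral mu setT k1 ->
  Rintegral mu setT f2 = - Rintegral mu setT k2 ->
  - Rintegral mu setT (fun x => f1 x + f2 x) =
  Rintegral mu setT (fun x => k1 x + k2 x).
Proof.
move=> i1 i2 j1 j2 e1 e2; rewrite (RintegralD measurableT i1 i2).
by rewrite (RintegralD measurableT j1 j2) e1 e2 opprD !opprK.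
Qed.

(** Real and imaginary parts converge along the same ultrafilter. If the limit vanished almost
    everywhere it would vanish identically by continuity, and uniform convergence on the unit square
    would contradict the points of modulus at least 1. *)
Lemma limit_solution (eps : R * R -> R) (lam A : R) (G : nat -> R * R -> R[i]%C)
    (N : nat -> nat) :
  continuous eps -> (forall m, (m < N m)%N) ->
  (forall m x, cabs (G m x) <= A) ->
  (forall eta, 0 < eta -> exists2 rho, 0 < rho &
    forall m x y, `|x - y| < rho -> cabs (G m x - G m y) <= eta) ->
  (forall m, exists2 x, `|x| <= 1 & 1 <= cabs (G m x)) ->
  (forall m (a b : int), let z := (a%:~R / (N m)%:R, b%:~R / (N m)%:R) in
     dlap (N m)%:R^-1 (re_part (G m)) z =
       - ((N m)%:R^-1 ^+ 2 * ((lam * eps z) * re_part (G m) z)) /\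
     dlap (N m)%:R^-1 (im_part (G m)) z =
       - ((N m)%:R^-1 ^+ 2 * ((lam * eps z) * im_part (G m) z))) ->
  exists E : R * R -> R[i]%C,
    [/\ cbounded E, nonzero E & distributional_solution eps lam E].
Proof.
move=> ceps Nm GA GE Gmass Geq.
have [U [UU ooU]] := ultraFilterLemma eventually_filter.
have ReB (x y : R[i]%C) : complex.Re (x - y) = complex.Re x - complex.Re y.
  by case: x y => a b [].
have ImB (x y : R[i]%C) : complex.Im (x - y) = complex.Im x - complex.Im y.
  by case: x y => a b [].
have [] := @ultra_equicontinuous R U UU _ (fun m => re_part (G m)) A.
- by move=> m x; exact: le_trans (cabs_Re _) (GA m x).
- move=> eta /GE[rho rho0 h]; exists rho => // m x y /(h m); apply: le_trans.
  by rewrite /re_part -ReB; exact: cabs_Re.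
move=> e1 [e1A ce1 he1].
have [] := @ultra_equicontinuous R U UU _ (fun m => im_part (G m)) A.
- by move=> m x; exact: le_trans (cabs_Im _) (GA m x).
- move=> eta /GE[rho rho0 h]; exists rho => // m x y /(h m); apply: le_trans.
  by rewrite /im_part -ImB; exact: cabs_Im.
move=> e2 [e2A ce2 he2].
exists (fun x => Complex (e1 x) (e2 x)); split.
- exists (A + A) => x; rewrite cabsE lecR.
  apply: le_trans (cabs_le_ReIm _) _; exact: (lerD (e1A x) (e2A x)).
- case=> Z [mZ Z0 ZE].
  have z1 : forall x, e1 x = 0.
    apply: continuous_ae0 => //; exists Z; split=> // x ne.
    by apply: ZE => /= -[*]; exact: ne.
  have z2 : forall x, e2 x = 0.
    apply: continuous_ae0 => //; exists Z; split=> // x ne.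
    by apply: ZE => /= -[*]; exact: ne.
  (* If both components are within [1/4] of 0 on the square, then [|G m| <= 1/2] there. *)
  have q0 : 0 < 4^-1 :> R by lra.
  have [m [h1 h2]] := filter_ex (filterI (he1 _ _ (@compact_square R 1) q0)
    (he2 _ _ (@compact_square R 1) q0)).
  have [x /norm_square x1] := Gmass m; have := cabs_le_ReIm (G m x).
  have := h1 x x1; have := h2 x x1; rewrite z1 z2 !subr0 /re_part /im_part.
  lra.
split.
  move=> K cK; split.
    exact: (bounded_continuous_integrable ce1 e1A).
  exact: (bounded_continuous_integrable ce2 e2A).
move=> phi [sp sq cphi].
set p := re_part phi in sp *; set q := im_part phi in sq *.
have /compact_bounded[M [Mr hM]] := cphi.
(* The margin 2 leaves a strip of width 1 inside the square on which [phi] vanishes, as summation by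
   parts demands. *)
pose B := (Num.truncn (`|M| + 2)).+1.
have MB : `|M| + 2 < B%:R by exact: truncnS_gt.
have phi0 z : B%:R - 1 <= `|z| -> phi z = 0.
  move=> zB; apply: contrapT => /eqP nz.
  have : `|z| <= `|M| + 1/2.
    apply: hM; first by rewrite (le_lt_trans (ler_norm _))// ltrDl; lra.
    by apply: subset_closure.
  lra.
have p0 z : B%:R - 1 <= `|z| -> p z = 0 by rewrite /p /re_part => /phi0 ->.
have q0 z : B%:R - 1 <= `|z| -> q z = 0 by rewrite /q /im_part => /phi0 ->.
pose kappa z := lam * eps z.
have ck : continuous kappa by move=> z; apply: cvgM; [exact: cvg_cst|exact: ceps].
have B1 : B%:R - 1 < B%:R :> R by lra.
have main (e : R * R -> R) (r : R * R -> R) (g : nat -> R * R -> R) :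
    continuous e ->
    (forall m x, `|g m x| <= A) ->
    (forall (K : set (R * R)) eta, compact K -> 0 < eta ->
      \forall m \near U, forall x, K x -> `|g m x - e x| <= eta) ->
    (forall m (a b : int), let z := (a%:~R / (N m)%:R, b%:~R / (N m)%:R) in
     dlap (N m)%:R^-1 (g m) z = - ((N m)%:R^-1 ^+ 2 * (kappa z * g m z))) ->
    smooth r -> (forall z, B%:R - 1 <= `|z| -> r z = 0) ->
    [/\ mu.-integrable setT (EFin \o (fun z => e z * laplacian r z)),
        mu.-integrable setT (EFin \o (fun z => kappa z * e z * r z)) &
        Rintegral mu setT (fun z => e z * laplacian r z) =
        - Rintegral mu setT (fun z => kappa z * e z * r z)].
  move=> ce gA ge geq sr r0.
  have r0' z : B%:R - 1 < `|z| -> r z = 0 by move=> /ltW; exact: r0.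
  split; last exact: (weak_limit UU ooU Nm gA ce ge ck geq _ sr r0).
  - apply: (riemann_cvg _ _).1.
      by move=> z; apply: cvgM; [exact: ce|exact: smooth_laplacian_continuous].
    by apply: (supported_norm B1) => z h; rewrite (laplacian_supported r0')// mulr0.
  - apply: (riemann_cvg _ _).1.
      move=> z; apply: cvgM; [apply: cvgM; [exact: ck|exact: ce]|].
      exact: (sr [::]).1.
    by apply: (supported_norm B1) => z h; rewrite r0'// mulr0.
have geq1 m a b := (Geq m a b).1.
have geq2 m a b := (Geq m a b).2.
have re1A m x : `|re_part (G m) x| <= A by exact: le_trans (cabs_Re _) (GA m x).
have im1A m x : `|im_part (G m) x| <= A by exact: le_trans (cabs_Im _) (GA m x).
(* As [kappa] is real, each component of [E] solves the equation by itself; pairing both with both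
   components of [phi] gives the four real identities behind the complex one. *)
have [i1 j1 w1] := main e1 p _ ce1 re1A he1 geq1 sp p0.
have [i2 j2 w2] := main e2 q _ ce2 im1A he2 geq2 sq q0.
have [i3 j3 w3] := main e1 q _ ce1 re1A he1 geq1 sq q0.
have [i4 j4 w4] := main e2 p _ ce2 im1A he2 geq2 sp p0.
rewrite /cintegral.
have reL : re_part (fun x => Complex (e1 x) (e2 x) * claplacian phi x) =
  (fun x => e1 x * laplacian p x - e2 x * laplacian q x) by [].
have imL : im_part (fun x => Complex (e1 x) (e2 x) * claplacian phi x) =
  (fun x => e1 x * laplacian q x + e2 x * laplacian p x) by [].
have reR : re_part (fun x => lam%:C * (eps x)%:C * Complex (e1 x) (e2 x) * phi x) =
  (fun x => kappa x * e1 x * p x - kappa x * e2 x * q x).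
  by apply/funext => x; rewrite /re_part /p /q /kappa /re_part /im_part;
    case: (phi x) => u v /=; ring.
have imR : im_part (fun x => lam%:C * (eps x)%:C * Complex (e1 x) (e2 x) * phi x) =
  (fun x => kappa x * e1 x * q x + kappa x * e2 x * p x).
  by apply/funext => x; rewrite /im_part /p /q /kappa /re_part /im_part;
    case: (phi x) => u v /=; ring.
have eqC (a b c d : R) : - a = c -> - b = d -> - Complex a b = Complex c d.
  by move=> <- <-.
rewrite reL imL reR imR; apply: eqC.
  exact: RintegralB_opp i1 i2 j1 j2 w1 w2.
exact: RintegralD_opp i3 i4 j3 j4 w3 w4.
Qed.

End LimitSolution.

(** * Discrete Fourier transform *)

Section Cis.
Variable R : realType.
Implicit Types (x y t : R).

Definition cis t : R[i]%C := Complex (cos t) (sin t).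

Lemma cisD x y : cis (x + y) = cis x * cis y.
Proof.
rewrite /cis cosD sinD; apply/eqP; rewrite eq_complex /=.
by apply/andP; split; apply/eqP; ring.
Qed.

Lemma cis0 : cis 0 = 1.
Proof. by rewrite /cis cos0 sin0. Qed.

Lemma conj_cis t : (cis t)^* = cis (- t).
Proof. by rewrite /cis cosN sinN. Qed.

Lemma cabs_cis t : cabs (cis t) = 1.
Proof. by rewrite /cis /= cos2Dsin2 sqrtr1. Qed.

Lemma cis_mulrn t n : cis (n%:R * t) = cis t ^+ n.
Proof.
elim: n => [|n IH]; first by rewrite mul0r cis0 expr0.
by rewrite -addn1 natrD mulrDl mul1r cisD IH addn1 exprSr.
Qed.

Lemma cis_2pi_nat n : cis (2 * pi * n%:R) = 1.
Proof.
rewrite mulrC cis_mulrn (_ : cis _ = 1) ?expr1n//.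
by rewrite /cis mulr_natl cos2pi sin2pi.
Qed.

Lemma cis_2pi_int (a : int) : cis (2 * pi * a%:~R) = 1.
Proof.
case: a => n; first exact: cis_2pi_nat.
by rewrite NegzE mulrNz mulrN -conj_cis cis_2pi_nat conjc1.
Qed.

Lemma sin_lip x y : `|sin x - sin y| <= `|x - y|.
Proof.
wlog xy : x y / y <= x.
  move=> h; have [/h//|/ltW/h] := leP y x.
  by rewrite distrC [leRHS]distrC.
have [c _ ->] := MVT_segment xy (fun z _ => is_derive_sin z)
  (continuous_subspaceT (@continuous_sin R)).
by rewrite normrM ler_piMl// cos_max.
Qed.

Lemma cos_lip x y : `|cos x - cos y| <= `|x - y|.
Proof.
rewrite -!sinDpihalf (le_trans (sin_lip _ _))// opprD addrACA subrr addr0.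
by [].
Qed.

Lemma cis_lip x y : cabs (cis x - cis y) <= 2 * `|x - y|.
Proof.
apply: le_trans (cabs_le_ReIm _) _; rewrite mulr_natl mulr2n.
by apply: lerD; [exact: cos_lip|exact: sin_lip].
Qed.

Lemma sin_sqr_le y : sin y ^+ 2 <= y ^+ 2.
Proof.
by have := sin_lip y 0; rewrite sin0 !subr0 -ler_sqr ?nnegrE// !real_normK ?num_real.
Qed.

(** With [z = y / 2], the mean value theorem gives [z cos z <= sin z], and doubling the angle gives
    [y cos^2 z <= sin y]. The bound is sharp near 0 and still effective for [y] well beyond
    [pi / 2]; both regimes are used. *)
Lemma sin_sqr_ge y : `|y| <= pi -> y ^+ 2 * cos (y / 2) ^+ 4 <= sin y ^+ 2.
Proof.
wlog y0 : y / 0 <= y.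
  move=> h; have [/h//|/ltW y0] := leP 0 y.
  by have := h (- y); rewrite normrN oppr_ge0 !sqrrN sinN sqrrN mulNr cosN; apply.
rewrite ger0_norm// => ypi; set z := y / 2.
have z0 : 0 <= z by rewrite divr_ge0.
have zpi : z <= pi / 2 by rewrite ler_pM2r.
have pi0 := @pi_gt0 R.
have cz : 0 <= cos z by apply: cos_ge0_pihalf; apply/andP; split; lra.
have sz : z * cos z <= sin z.
  have [c] := MVT_segment z0 (fun z _ => is_derive_sin z)
    (continuous_subspaceT (@continuous_sin R)).
  rewrite in_itv/= sin0 !subr0 => /andP[c0 cz'] ->.
  rewrite mulrC ler_wpM2r//.
  have [->//|zc] := eqVneq z c.
  rewrite ltW// ltr_cos ?in_itv/= ?lt_neqAle 1?eq_sym ?zc//; apply/andP; split; lra.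
have -> : y = z *+ 2 by rewrite /z -mulr_natr divfK// pnatr_eq0.
rewrite sin_mulr2n.
have : 0 <= (sin z - z * cos z) * (sin z + z * cos z) * cos z ^+ 2 * 4.
  rewrite !mulr_ge0 ?sqr_ge0 ?subr_ge0// addr_ge0//; last exact: mulr_ge0.
  by rewrite (le_trans _ sz)// mulr_ge0.
rewrite !mulr2n; lra.
Qed.

Lemma two_sub_2cos t : 2 - 2 * cos t = 4 * sin (t / 2) ^+ 2.
Proof.
rewrite {1}(_ : t = (t / 2) *+ 2); last by rewrite -mulr_natr divfK// pnatr_eq0.
by rewrite cos_mulr2n cos2sin2 !mulr2n; ring.
Qed.

Lemma cis_neq1 t : 0 < t < 2 * pi -> cis t != 1.
Proof.
move=> /andP[t0 t2]; apply/eqP => -[c1 _].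
have := two_sub_2cos t; rewrite c1.
have s0 : 0 < sin (t / 2) by apply: sin_gt0_pi; apply/andP; split; lra.
by have := exprn_gt0 2 s0; lra.
Qed.

(** A full geometric sum of a nontrivial root of unity. *)
Lemma sum_cis (N a b : nat) : (a < N)%N -> (b < N)%N -> a != b ->
  \sum_(k < N) cis (k%:R * (2 * pi * (a%:R - b%:R) / N%:R)) = 0.
Proof.
wlog ab : a b / (b < a)%N.
  move=> h aN bN; rewrite neq_ltn => /orP[ba|ab]; last first.
    by apply: h => //; rewrite gtn_eqF.
  transitivity ((\sum_(k < N) cis (k%:R * (2 * pi * (b%:R - a%:R) / N%:R)))^*).
    rewrite rmorph_sum; apply: eq_bigr => k _.
    by rewrite [RHS]conj_cis; congr cis; ring.
  by rewrite h ?conjc0// gtn_eqF.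
move=> aN bN _; set t := _ / _.
have N0 : (0 : R) < N%:R by rewrite ltr0n (leq_ltn_trans _ aN).
have pi0 := @pi_gt0 R.
have z1 : cis t - 1 != 0.
  rewrite subr_eq0 cis_neq1//; apply/andP; split.
    by rewrite divr_gt0// mulr_gt0 ?mulr_gt0// subr_gt0 ltr_nat.
  rewrite ltr_pdivrMr// ltr_pM2l ?mulr_gt0//.
  have : (a%:R : R) < N%:R by rewrite ltr_nat.
  by have : (0 : R) <= b%:R by []; lra.
apply: (mulfI z1); rewrite mulr0; under eq_bigr do rewrite cis_mulrn.
rewrite -subrX1 -cis_mulrn mulrCA divff ?gt_eqF// mulr1 mulrBr cisD -conj_cis.
by rewrite !cis_2pi_nat conjc1 mulr1 subrr.
Qed.

End Cis.

(** * Bloch sums on the grid *)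

Section DiscreteBloch.
Variables (R : realType) (M : nat).
Local Notation N := (2 * M).+1.
Local Notation T := ('I_N * 'I_N)%type.
Implicit Types (k xi x : R * R) (n m : T).

(* The index [i] stands for the frequency [i - M], between [-M] and [M]. *)
Definition freq (i : nat) : R := i%:R - M%:R.

Definition wave k n : R * R := (k.1 + 2 * pi * freq n.1, k.2 + 2 * pi * freq n.2).

Definition plane_wave xi x : R[i]%C := cis (xi.1 * x.1 + xi.2 * x.2).

(* Symbol of minus the five-point Laplacian of mesh [1 / N]. *)
Definition symbol xi : R :=
  N%:R ^+ 2 * (4 - 2 * cos (xi.1 / N%:R) - 2 * cos (xi.2 / N%:R)).

(** The factor [1 / N] is the unitary normalisation on [N^2] points. *)
Definition dft n (x : T) : R[i]%C :=
  (N%:R^-1)%:C * cis (2 * pi * (freq n.1 * x.1%:R + freq n.2 * x.2%:R) / N%:R).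

Lemma sum_cis_delta (i j : 'I_N) :
  \sum_(a < N) cis (a%:R * (2 * pi * (i%:R - j%:R) / N%:R) : R) =
  N%:R *+ (i == j).
Proof.
have [->|ij] := eqVneq i j; last by rewrite mulr0n sum_cis.
under eq_bigr do rewrite subrr mulr0 mul0r mulr0 cis0.
by rewrite sumr_const card_ord.
Qed.

Lemma sum_cis_freq_delta (a b : 'I_N) :
  \sum_(i < N) cis (freq i * (2 * pi * (a%:R - b%:R) / N%:R)) = N%:R *+ (a == b).
Proof.
set t := _ / _; under eq_bigr do rewrite mulrDl cisD.
rewrite -mulr_suml sum_cis_delta; have [ab|] := eqVneq a b; last by rewrite mul0r.
by rewrite /t ab subrr mulr0 mul0r mulr0 cis0 mulr1.
Qed.

Lemma sum_pair_prod (f g : 'I_N -> R[i]%C) :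
  \sum_(x : T) f x.1 * g x.2 = (\sum_i f i) * (\sum_j g j).
Proof. by rewrite big_distrlr/= pair_bigA. Qed.

Lemma delta_pair (n m : T) (c : R[i]%C) : c != 0 ->
  c^-1 ^+ 2 * ((c *+ (n.1 == m.1)) * (c *+ (n.2 == m.2))) = (n == m)%:R.
Proof.
move=> c0; have -> : (n == m) = (n.1 == m.1) && (n.2 == m.2) by [].
case: (n.1 == m.1); case: (n.2 == m.2); rewrite ?mul0r ?mulr0//=.
by field.
Qed.

Lemma dft_unitary n m : \sum_x dft n x * (dft m x)^* = (n == m)%:R.
Proof.
have N0 : N%:R != 0 :> R[i]%C by rewrite pnatr_eq0.
rewrite -(delta_pair _ _ N0) -!sum_cis_delta -sum_pair_prod mulr_sumr.
apply: eq_bigr => x _; rewrite /dft conjcM conjc_real conj_cis -cisD.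
rewrite mulrACA -cisD fmorphV rmorph_nat expr2; congr (_ * cis _).
rewrite /freq; have : (N%:R : R) != 0 by rewrite pnatr_eq0.
by move: (N%:R : R) => v v0; field.
Qed.

Lemma dft_unitary' (x y : T) : \sum_n dft n x * (dft n y)^* = (x == y)%:R.
Proof.
have N0 : N%:R != 0 :> R[i]%C by rewrite pnatr_eq0.
rewrite -(delta_pair _ _ N0) -!sum_cis_freq_delta -sum_pair_prod mulr_sumr.
apply: eq_bigr => n _; rewrite /dft conjcM conjc_real conj_cis -cisD.
rewrite mulrACA -cisD fmorphV rmorph_nat expr2; congr (_ * cis _).
rewrite /freq; have : (N%:R : R) != 0 by rewrite pnatr_eq0.
by move: (N%:R : R) => v v0; field.
Qed.

(** A trigonometric interpolation, defined on the whole plane so that solutions on different grids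
    can be compared and passed to the limit. *)
Definition bloch k (c : T -> R[i]%C) x : R[i]%C := \sum_n c n * plane_wave (wave k n) x.

Definition node_point (x : T) : R * R := (x.1%:R / N%:R, x.2%:R / N%:R).

Lemma plane_wave_node k n (x : T) :
  plane_wave (wave k n) (node_point x) =
  plane_wave k (node_point x) * (N%:R * dft n x).
Proof.
rewrite /dft fmorphV rmorph_nat mulVKf ?pnatr_eq0// /plane_wave -cisD.
congr cis; rewrite /wave /node_point /=; have : (N%:R : R) != 0 by rewrite pnatr_eq0.
by move: (N%:R : R) => v v0; field.
Qed.

Lemma plane_waveD xi x y : plane_wave xi (x + y) = plane_wave xi x * plane_wave xi y.
Proof. by rewrite /plane_wave -cisD /=; congr cis; ring. Qed.

Lemma plane_wave_int k n (a b : int) :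
  plane_wave (wave k n) (a%:~R, b%:~R) = plane_wave k (a%:~R, b%:~R).
Proof.
have freqE (i : 'I_N) : freq i = (i%:Z - M%:Z)%:~R by rewrite intrB.
rewrite /plane_wave /wave /= !freqE.
rewrite (_ : _ + _ = (k.1 * a%:~R + k.2 * b%:~R) +
  2 * pi * ((n.1%:Z - M%:Z) * a + (n.2%:Z - M%:Z) * b)%:~R).
  by rewrite cisD cis_2pi_int mulr1.
by rewrite !(intrD, intrM); ring.
Qed.

Lemma bloch_int k c x (a b : int) :
  bloch k c (x + (a%:~R, b%:~R)) = plane_wave k (a%:~R, b%:~R) * bloch k c x.
Proof.
rewrite /bloch mulr_sumr; apply: eq_bigr => n _.
by rewrite plane_waveD plane_wave_int; ring.
Qed.

Lemma grid_decompose (a b : int) : exists (x : T) (q r : int),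
  (a%:~R / N%:R, b%:~R / N%:R) = node_point x + (q%:~R, r%:~R).
Proof.
have dec (d : int) : exists (i : 'I_N) (q : int),
    d%:~R / N%:R = i%:R / N%:R + q%:~R :> R.
  have lt : (absz (modz d N) < N)%N.
    by rewrite -ltz_nat gez0_abs ?modz_ge0// ltz_pmod.
  exists (Ordinal lt), (divz d N) => /=.
  have e : d%:~R = (absz (modz d N))%:R + (divz d N)%:~R * N%:R :> R.
    have -> : ((absz (modz d N))%:R : R) = (modz d N)%:~R.
      by rewrite -[in RHS](@gez0_abs (modz d N)) ?modz_ge0.
    by rewrite [in LHS](divz_eq d N) intrD intrM addrC.
  by rewrite e mulrDl mulfK// pnatr_eq0.
have [i [q hi]] := dec a; have [j [r hj]] := dec b.
by exists (i, j), q, r; rewrite hi hj.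
Qed.

Lemma bloch_dlap k c x :
  let h : R := N%:R^-1 in
  bloch k c (x.1 + h, x.2) + bloch k c (x.1 - h, x.2) + bloch k c (x.1, x.2 + h) +
    bloch k c (x.1, x.2 - h) - 4 * bloch k c x =
  - (h ^+ 2)%:C * \sum_n (symbol (wave k n))%:C * c n * plane_wave (wave k n) x.
Proof.
move=> h; rewrite /bloch !mulr_sumr -!big_split/= -sumrN -big_split/=.
apply: eq_bigr => n _; set xi := wave k n.
have E1 : cis (xi.1 * h) + cis (xi.1 * - h) = (2 * cos (xi.1 * h))%:C :> R[i]%C.
  by rewrite mulrN -conj_cis addcJ rmorphM rmorph_nat.
have E2 : cis (xi.2 * h) + cis (xi.2 * - h) = (2 * cos (xi.2 * h))%:C :> R[i]%C.
  by rewrite mulrN -conj_cis addcJ rmorphM rmorph_nat.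
have P1 (d : R) : plane_wave xi (x.1 + d, x.2) = plane_wave xi x * cis (xi.1 * d).
  by rewrite /plane_wave -cisD /=; congr cis; ring.
have P2 (d : R) : plane_wave xi (x.1, x.2 + d) = plane_wave xi x * cis (xi.2 * d).
  by rewrite /plane_wave -cisD /=; congr cis; ring.
rewrite !P1 !P2.
transitivity (c n * plane_wave xi x *
  ((cis (xi.1 * h) + cis (xi.1 * - h)) + (cis (xi.2 * h) + cis (xi.2 * - h)) - 4)).
  by ring.
rewrite E1 E2.
have e : (h ^+ 2)%:C * (symbol xi)%:C =
    4 - (2 * cos (xi.1 * h))%:C - (2 * cos (xi.2 * h))%:C :> R[i]%C.
  rewrite -(rmorph_nat (real_complex R) 4) -!rmorphB -[LHS]rmorphM; congr (_%:C).
  by rewrite /symbol /h exprVn mulKf ?expf_neq0 ?pnatr_eq0.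
transitivity (- ((h ^+ 2)%:C * (symbol xi)%:C) * (c n * plane_wave xi x)).
  by rewrite e; ring.
by ring.
Qed.

End DiscreteBloch.

Section DiscreteBlochSolution.
Variables (R : realType) (M : nat).
Local Notation N := (2 * M).+1.
Local Notation T := ('I_N * 'I_N)%type.

Lemma bloch_node (k : R * R) (c : T -> R[i]%C) (y : T) :
  bloch k c (node_point R y) =
  plane_wave k (node_point R y) * N%:R * \sum_n c n * dft R n y.
Proof.
rewrite /bloch mulr_sumr; apply: eq_bigr => n _.
by rewrite plane_wave_node; ring.
Qed.

Lemma symbol_continuous (f : R -> R * R) (n : T) :
  continuous (fun t => (f t).1) -> continuous (fun t => (f t).2) ->
  continuous (fun t => symbol M (wave (f t) n)).
Proof.
move=> c1 c2 t; rewrite /symbol /wave /=.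
have cc (g : R -> R) (a : R) : continuous g ->
    (fun t => 2 * cos ((g t + a) / N%:R)) @ t --> 2 * cos ((g t + a) / N%:R).
  move=> cg; apply: cvgM; first exact: cvg_cst.
  apply: (@continuous_comp _ _ _ (fun t => (g t + a) / N%:R) cos); last exact: continuous_cos.
  by apply: cvgM; [apply: cvgD; [exact: cg|exact: cvg_cst]|exact: cvg_cst].
apply: cvgM; first exact: cvg_cst.
apply: cvgB; last exact: (cc (fun t => (f t).2)).
by apply: cvgB; [exact: cvg_cst|exact: (cc (fun t => (f t).1))].
Qed.

(** [eigenvector_crossing] is applied to the samples of [lam * eps] on one period cell.
    Quasi-periodicity of Bloch sums and periodicity of [eps] extend the resulting equation to the
    whole grid. *)
Lemma discrete_bloch (eps : R * R -> R) (lam v : R) (kf : R -> R * R) :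
  Z2_periodic eps -> (forall x, `|lam * eps x - lam| <= v) ->
  continuous (fun t => (kf t).1) -> continuous (fun t => (kf t).2) ->
  (forall n : T, v < `|symbol M (wave (kf 0) n) - lam|) ->
  (forall n : T, v < `|symbol M (wave (kf 1) n) - lam|) ->
  (\prod_(n : T) (symbol M (wave (kf 0) n) - lam)) *
  (\prod_(n : T) (symbol M (wave (kf 1) n) - lam)) < 0 ->
  exists t, 0 <= t <= 1 /\ exists c : T -> R[i]%C,
    [/\ \sum_n cabs (c n) ^+ 2 = 1,
        \sum_n symbol M (wave (kf t) n) ^+ 2 * cabs (c n) ^+ 2 <= (`|lam| + v) ^+ 2,
        exists2 x, `|x| <= 1 & 1 <= cabs (bloch (kf t) c x) &
        forall a b : int, let z := (a%:~R / N%:R, b%:~R / N%:R) in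
          dlap N%:R^-1 (re_part (bloch (kf t) c)) z =
            - (N%:R^-1 ^+ 2 * ((lam * eps z) * re_part (bloch (kf t) c) z)) /\
          dlap N%:R^-1 (im_part (bloch (kf t) c)) z =
            - (N%:R^-1 ^+ 2 * ((lam * eps z) * im_part (bloch (kf t) c) z))].
Proof.
move=> peps heps c1 c2 w0 w1 wprod.
pose W (x : T) := lam * eps (node_point R x).
have [] := @eigenvector_crossing R T (@dft R M) W lam v
  (fun t n => symbol M (wave (kf t) n)) (@dft_unitary R M) (@dft_unitary' R M)
  _ _ w0 w1 wprod.
- by move=> x; exact: heps.
- by move=> n; exact: symbol_continuous.
move=> t [t01 [c0 [[n0 c0n0] hc0]]]; exists t; split => //.
pose w (n : T) := symbol M (wave (kf t) n).
pose S := \sum_n cabs (c0 n) ^+ 2.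
have S0 : 0 < S.
  rewrite /S (bigD1 n0)//= ltr_pwDl ?sumr_ge0// => [|n _]; last exact: sqr_ge0.
  rewrite exprn_gt0// lt_neqAle cabs_ge0 andbT eq_sym.
  by apply: contra c0n0 => /eqP/Normc.eq0_normc ->.
pose s := Num.sqrt S; have s0 : 0 < s by rewrite sqrtr_gt0.
pose c n := (s^-1)%:C * c0 n.
have hc m : c m * (w m)%:C =
    \sum_x (W x)%:C * (\sum_n c n * dft R n x) * (dft R m x)^*.
  rewrite /c -mulrA hc0 mulr_sumr; apply: eq_bigr => x _.
  under [in RHS]eq_bigr do rewrite -mulrA.
  by rewrite -mulr_sumr; ring.
have c1' : \sum_n cabs (c n) ^+ 2 = 1.
  rewrite /c; under eq_bigr do rewrite Normc.normcM exprMn cabs_real.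
  rewrite -mulr_sumr -/S ger0_norm ?invr_ge0 ?sqrtr_ge0// exprVn sqr_sqrtr ?ltW//.
  by rewrite mulVf// gt_eqF.
have f1 : \sum_x cabs (\sum_n c n * dft R n x) ^+ 2 = 1.
  by rewrite (parseval c (@dft_unitary R M)).
exists c; split => //.
(* The products of symbol and coefficient are the transform of [W] times the grid function, so
   Parseval bounds them by the supremum of [|W|]. *)
- have -> : \sum_n symbol M (wave (kf t) n) ^+ 2 * cabs (c n) ^+ 2 =
      \sum_x cabs ((W x)%:C * (\sum_n c n * dft R n x)) ^+ 2.
    rewrite -(parseval_conj _ (@dft_unitary' R M)); apply: eq_bigr => m _.
    by rewrite -hc (Normc.normcM (c m)) cabs_real [RHS]exprMn real_normK ?num_real// mulrC.
  rewrite -[leRHS]mulr1 -f1 mulr_sumr; apply: ler_sum => x _.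
  rewrite Normc.normcM exprMn cabs_real ler_wpM2r ?sqr_ge0//.
  rewrite lerXn2r ?nnegrE// ?addr_ge0//; first exact: le_trans (heps 0).
  rewrite -[W x](subrK lam) addrC; apply: le_trans (ler_normD _ _) _.
  by rewrite lerD2l; exact: heps.
(* The squared moduli of [N^2] values sum to 1, so one of them is at least [N^-2]; the factor [N] in
   [bloch_node] raises this modulus to 1. *)
- have [x hx] : exists x, (N%:R^-1 : R) ^+ 2 <= cabs (\sum_n c n * dft R n x) ^+ 2.
    apply: contrapT => hn.
    have : \sum_x cabs (\sum_n c n * dft R n x) ^+ 2 < \sum_(x : T) (N%:R^-1) ^+ 2.
      apply: ltr_sum => [|x _]; first by apply/hasP; exists n0 => //; exact: mem_index_enum.
      by rewrite ltNge; apply/negP => h; apply: hn; exists x.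
    rewrite f1 sumr_const card_prod card_ord -[X in _ < X]mulr_natr natrM -expr2 -exprMn.
    by rewrite mulVf ?pnatr_eq0// expr1n ltxx.
  exists (node_point R x).
    have b (i : 'I_N) : `|i%:R / N%:R : R| <= 1.
      by rewrite ger0_norm ?divr_ge0// ler_pdivrMr// mul1r ler_nat ltnW.
    by rewrite prod_normE/= ge_max !b.
  rewrite bloch_node !Normc.normcM cabs_cis mul1r.
  rewrite -(rmorph_nat (real_complex R)) cabs_real ger0_norm//.
  rewrite mulrC -ler_pdivrMr// div1r -(@ler_pXn2r _ 2)// nnegrE ?invr_ge0//.
  exact: cabs_ge0.
move=> a b z; have [y [q [r hz]]] := grid_decompose R M a b.
(* Fourier inversion turns the equation between coefficients into a pointwise one at the nodes of
   the cell. *)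
have eqy : bloch (kf t) (fun n => (w n)%:C * c n) (node_point R y) =
    (W y)%:C * bloch (kf t) c (node_point R y).
  rewrite !bloch_node mulrCA; congr (_ * _).
  under eq_bigr do rewrite [_%:C * _]mulrC hc mulr_suml.
  rewrite exchange_big/= (bigD1 y)//= [X in _ + X]big1 => [|x xy].
    rewrite addr0; under eq_bigr do rewrite -mulrA [X in _ * X]mulrC.
    by rewrite -mulr_sumr dft_unitary' eqxx mulr1.
  under eq_bigr do rewrite -mulrA [X in _ * X]mulrC.
  by rewrite -mulr_sumr dft_unitary' eq_sym (negbTE xy) mulr0.
have epsz : eps z = eps (node_point R y).
  by rewrite /z hz; exact: (peps (node_point R y) q r).
have eqz : bloch (kf t) (fun n => (w n)%:C * c n) z = (lam * eps z)%:C * bloch (kf t) c z.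
  by rewrite epsz /z hz !bloch_int eqy /W; ring.
have := bloch_dlap (kf t) c z; rewrite -/(bloch (kf t) (fun n => (w n)%:C * c n) z) eqz.
have -> x : 4 * x = x + x + x + x :> R[i]%C by ring.
rewrite /dlap /re_part /im_part; set G := bloch _ _; set h : R := N%:R^-1.
case: (G (_, _)) => a1 b1; case: (G (_, _)) => a2 b2; case: (G (_, _)) => a3 b3.
case: (G (_, _)) => a4 b4; case: (G z) => a5 b5 /= [e1 e2]; split.
  by move: e1; lra.
by move: e2; lra.
Qed.

End DiscreteBlochSolution.

(** * Summability of the Fourier coefficients *)

Section FrequencySums.
Variable R : realType.
Implicit Types (M L : nat) (x : R).

(** A separable weight: up to a constant, [decay f * decay g] dominates the inverse square of the
    symbol, and its double sum factors. *)
Definition decay x : R := (1 + x ^+ 2)^-1.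

Lemma decay_gt0 x : 0 < decay x.
Proof. by rewrite invr_gt0 ltr_wpDr ?sqr_ge0. Qed.

Lemma decayN x : decay (- x) = decay x.
Proof. by rewrite /decay sqrrN. Qed.

Lemma sum_freq_step (F : R -> R) M :
  \sum_(i < (2 * M.+1).+1) F (freq R M.+1 i) =
  F (- M.+1%:R) + \sum_(i < (2 * M).+1) F (freq R M i) + F M.+1%:R.
Proof.
rewrite mulnS add2n [LHS]big_ord_recr big_ord_recl /=; congr (_ + _ + _).
- by rewrite /freq sub0r.
- apply: eq_bigr => i _; congr F; rewrite /freq /= /bump leq0n add1n.
  by rewrite -(natr1 i) -(natr1 M); ring.
- by congr F; rewrite /freq -(natr1 (2 * M).+1) -(natr1 (2 * M)) -(natr1 M) natrM; ring.
Qed.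

(* [1 / (1 + m^2) <= 2 (1 / m - 1 / (m + 1))] makes the sums telescope. *)
Lemma decay_telescope M : decay M.+1%:R <= 2 * (M.+1%:R^-1 - M.+2%:R^-1).
Proof.
rewrite /decay -[M.+2]addn1 natrD; set m : R := M.+1%:R.
have m1 : 1 <= m by rewrite ler1n.
have m0 : 0 < m by lra.
have q0 : 0 < 1 + m ^+ 2 by rewrite ltr_wpDr ?sqr_ge0.
rewrite (_ : _ - _ = (m * (m + 1))^-1); last by field; lra.
rewrite -[leLHS]div1r ler_pdivrMr// mulrAC ler_pdivlMr; nra.
Qed.

Lemma sum_decay M : \sum_(i < (2 * M).+1) decay (freq R M i) <= 5.
Proof.
(* The stronger claim telescopes: 1 for frequency zero, then twice [2 * (1 - 1 / M.+1)] for the two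
   signs. *)
suff : \sum_(i < (2 * M).+1) decay (freq R M i) <= 5 - 4 * M.+1%:R^-1.
  by move=> h; apply: le_trans h _; rewrite gerBl mulr_ge0.
elim: M => [|M IH].
  by rewrite big_ord_recl big_ord0 /decay /freq subrr expr0n /= !addr0 invr1; lra.
rewrite (sum_freq_step decay) decayN; have := decay_telescope M; move: IH.
move: (\sum_(i < _) _) (decay _) (_^-1) (_^-1) => ? ? ? ?; lra.
Qed.

Lemma sum_decay_tail L M :
  \sum_(i < (2 * M).+1 | L%:R < `|freq R M i|) decay (freq R M i) <= 4 / L.+1%:R.
Proof.
pose G (x : R) := if L%:R < `|x| then decay x else 0.
have F m : \sum_(i < (2 * m).+1 | L%:R < `|freq R m i|) decay (freq R m i) =
    \sum_(i < (2 * m).+1) G (freq R m i) by rewrite big_mkcond.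
have small m : (m <= L)%N ->
    \sum_(i < (2 * m).+1 | L%:R < `|freq R m i|) decay (freq R m i) = 0.
  move=> mL; rewrite big_pred0// => i; apply/negbTE; rewrite -leNgt /freq ler_norml.
  have : (m%:R : R) <= L%:R by rewrite ler_nat.
  have : (i%:R : R) <= 2 * m%:R by rewrite -natrM ler_nat -ltnS.
  have : (0 : R) <= i%:R by [].
  by move=> ? ? ?; apply/andP; split; lra.
have [ML|LM] := leqP M L; first by rewrite small// divr_ge0.
rewrite -(subnKC (ltnW LM)); set d := (M - L)%N.
(* Again a telescoping bound, where 4 is the factor 2 of [decay_telescope] for each of the two
   signs. *)
suff : \sum_(i < (2 * (L + d)).+1 | L%:R < `|freq R (L + d) i|)
    decay (freq R (L + d) i) <= 4 * (L.+1%:R^-1 - (L + d).+1%:R^-1).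
  by move=> h; apply: le_trans h _; rewrite ler_wpM2l// gerBl.
elim: d => [|d IH]; first by rewrite addn0 small// subrr mulr0.
rewrite addnS F (sum_freq_step G) -F /G normrN normr_nat ltr_nat ltnS leq_addr decayN.
have := decay_telescope (L + d); move: IH.
move: (\sum_(i < _ | _) _) (decay _) (_^-1) (_^-1) (_^-1) => ? ? ? ? ?; lra.
Qed.

End FrequencySums.

(** * Coercivity of the discrete symbol *)

Section SymbolBound.
Variables (R : realType) (M : nat) (K : R).
Local Notation N := (2 * M).+1.
Local Notation T := ('I_N * 'I_N)%type.
Hypothesis K1 : 1 <= K.
Hypothesis KM : K <= M%:R.

(** The value at [|t| = 4 pi / 3] of the factor [cos (t / 4) ^+ 4] furnished by [sin_sqr_ge]. *)
Definition sym_cst : R := cos (pi / 3) ^+ 4.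

Lemma sym_cst_gt0 : 0 < sym_cst.
Proof.
have := @pi_gt0 R => pi0; apply: exprn_gt0; apply: cos_gt0_pihalf.
by apply/andP; split; lra.
Qed.

Lemma freq_bound (i : 'I_N) : `|freq R M i| <= M%:R.
Proof.
rewrite /freq ler_norml.
have : (i%:R : R) <= 2 * M%:R by rewrite -natrM ler_nat -ltnS.
have : (0 : R) <= i%:R by [].
by move=> ? ?; apply/andP; split; lra.
Qed.

(** The quasimomentum may push [xi / N] out of [[-pi, pi]]; as [K <= M], it stays within [4 pi / 3],
    away from [2 pi], where the cosine symbol would vanish again. *)
Lemma symbol1_ge (kj : R) (i : 'I_N) : `|kj| <= K ->
  sym_cst * (kj + 2 * pi * freq R M i) ^+ 2 <=
  N%:R ^+ 2 * (2 - 2 * cos ((kj + 2 * pi * freq R M i) / N%:R)).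
Proof.
move=> kK; set xi := kj + _.
have pi2 := @pi_ge2 R.
have N0 : (0 : R) < N%:R by rewrite ltr0n.
have NE : N%:R = 2 * M%:R + 1 :> R by rewrite -addn1 natrD natrM.
have xi_le : `|xi| <= K + 2 * pi * M%:R.
  apply: le_trans (ler_normD _ _) _; apply: lerD => //.
  by rewrite normrM ger0_norm ?mulr_ge0 ?pi_ge0// ler_wpM2l ?freq_bound// mulr_ge0 ?pi_ge0.
have M0 : (0 : R) <= M%:R by [].
have xiN : `|xi / N%:R| <= 4 * pi / 3.
  rewrite normrM normfV (ger0_norm (ltW N0)) ler_pdivrMr// (le_trans xi_le)//.
  have : 0 <= (pi - 2) * (M%:R : R) by rewrite mulr_ge0// subr_ge0.
  by move: KM; rewrite NE; lra.
set t := xi / N%:R in xiN *; rewrite two_sub_2cos.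
have xiE : xi = N%:R * t by rewrite /t mulrCA divff ?mulr1// gt_eqF.
rewrite xiE exprMn mulrCA ler_pM2l ?exprn_gt0//.
have /sin_sqr_ge : `|t / 2| <= pi.
  by rewrite normrM [`|2^-1|]ger0_norm//; lra.
rewrite (_ : t / 2 / 2 = t / 4); last by lra.
move=> h; apply: (@le_trans _ _ (4 * ((t / 2) ^+ 2 * cos (t / 4) ^+ 4))); last by lra.
rewrite (_ : 4 * _ = cos (t / 4) ^+ 4 * t ^+ 2); last by field.
rewrite ler_wpM2r ?sqr_ge0// /sym_cst.
rewrite lerXn2r ?nnegrE//.
- by apply: cos_ge0_pihalf; apply/andP; split; lra.
- move: xiN; rewrite ler_norml => /andP[? ?].
  by apply: cos_ge0_pihalf; apply/andP; split; lra.
rewrite -(cos_norm (t / 4)); have t4 : `|t / 4| <= pi / 3.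
  by rewrite normrM [`|4^-1|]ger0_norm//; lra.
have [->//|ne] := eqVneq (pi / 3) `|t / 4|.
have := normr_ge0 (t / 4) => t40.
rewrite ltW// ltr_cos ?in_itv/= ?lt_neqAle 1?eq_sym ?ne//; apply/andP; split; lra.
Qed.

Lemma one_sub_cos_ge0 (a : R) : 0 <= 2 - 2 * cos a.
Proof. by have := cos_le1 a; lra. Qed.

(** Since [pi >= 2] and [|kj| < |f|], one has [2 pi |f| - |kj| >= 3 |f|]. *)
Lemma wave_ge (kj f : R) : `|kj| <= K -> K < `|f| ->
  9 * f ^+ 2 <= (kj + 2 * pi * f) ^+ 2.
Proof.
move=> kK Ki; have pi2 := @pi_ge2 R.
have -> : 9 * f ^+ 2 = (3 * `|f|) ^+ 2 by rewrite exprMn real_normK ?num_real//; ring.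
rewrite -[leRHS]real_normK ?num_real// lerXn2r ?nnegrE//.
have : `|2 * pi * f| <= `|kj + 2 * pi * f| + `|kj|.
  by rewrite -{1}[2 * pi * f](addKr kj) addrC; exact: ler_normB.
rewrite !normrM (ger0_norm (@pi_ge0 R)) [`|2|]ger0_norm//.
have := normr_ge0 f; nra.
Qed.

(** The larger frequency [f] controls both weights: the symbol is at least [9 C f^2], and
    [(1 + f^2) (1 + g^2) <= 4 f^4] when [|g| <= |f|] and [|f| >= 1]. *)
Lemma symbol_ge (k : R * R) (n : T) : `|k.1| <= K -> `|k.2| <= K ->
  (K < `|freq R M n.1|) || (K < `|freq R M n.2|) ->
  sym_cst ^+ 2 <= symbol M (wave k n) ^+ 2 * (decay (freq R M n.1) * decay (freq R M n.2)).
Proof.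
move=> k1 k2 h.
have main (f g w : R) : K < `|f| -> `|g| <= `|f| -> sym_cst * (9 * f ^+ 2) <= w ->
    sym_cst ^+ 2 <= w ^+ 2 * (decay f * decay g).
  move=> Kf gf hw; rewrite /decay -invfM.
  have f1 : 1 < `|f| by apply: le_lt_trans Kf.
  have ff : 1 <= f ^+ 2 by rewrite -real_normK ?num_real//; nra.
  have gg : g ^+ 2 <= f ^+ 2.
    by rewrite -[leLHS]real_normK ?num_real// -[leRHS]real_normK ?num_real// lerXn2r ?nnegrE.
  have g0 := sqr_ge0 g.
  have s0 := sym_cst_gt0.
  rewrite ler_pdivlMr ?mulr_gt0//; try lra.
  apply: (@le_trans _ _ ((sym_cst * (9 * f ^+ 2)) ^+ 2)); last first.
    have z0 : 0 <= sym_cst * (9 * f ^+ 2).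
      by rewrite mulr_ge0 ?(ltW s0)// mulr_ge0// sqr_ge0.
    by rewrite lerXn2r ?nnegrE// (le_trans z0).
  rewrite [leRHS]exprMn ler_wpM2l ?sqr_ge0//; nra.
have S : symbol M (wave k n) =
    N%:R ^+ 2 * (2 - 2 * cos ((k.1 + 2 * pi * freq R M n.1) / N%:R)) +
    N%:R ^+ 2 * (2 - 2 * cos ((k.2 + 2 * pi * freq R M n.2) / N%:R)).
  by rewrite /symbol /wave /=; ring.
have s0 := ltW sym_cst_gt0.
have W1 := symbol1_ge n.1 k1; have W2 := symbol1_ge n.2 k2.
have P1 := mulr_ge0 (sqr_ge0 N%:R) (one_sub_cos_ge0 ((k.1 + 2 * pi * freq R M n.1) / N%:R)).
have P2 := mulr_ge0 (sqr_ge0 N%:R) (one_sub_cos_ge0 ((k.2 + 2 * pi * freq R M n.2) / N%:R)).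
have [gf|/ltW fg] := leP `|freq R M n.2| `|freq R M n.1|.
  have Kf : K < `|freq R M n.1| by case/orP: h => // h'; exact: lt_le_trans gf.
  apply: main => //; rewrite S.
  have := ler_wpM2l s0 (wave_ge k1 Kf); lra.
have Kg : K < `|freq R M n.2| by case/orP: h => // h'; exact: lt_le_trans fg.
rewrite [decay _ * _]mulrC; apply: main => //; rewrite S.
have := ler_wpM2l s0 (wave_ge k2 Kg); lra.
Qed.

End SymbolBound.

(** * Bounds on Bloch sums uniform in the mesh *)

Section BlochEstimates.
Variables (R : realType) (K W : R).
Hypothesis K1 : 1 <= K.
Local Notation modes M := ('I_(2 * M).+1 * 'I_(2 * M).+1)%type.

Definition high (L M : nat) (n : modes M) : bool :=
  (L%:R < `|freq R M n.1|) || (L%:R < `|freq R M n.2|).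

Lemma sum_modes_prod (M : nat) (f g : 'I_(2 * M).+1 -> R) :
  \sum_(n : modes M) f n.1 * g n.2 = (\sum_i f i) * (\sum_j g j).
Proof. by rewrite big_distrlr/= pair_bigA. Qed.

(** One of the two frequencies lies in the tail, so the sum is at most twice a tail [4 / L.+1] times
    a full sum 5. *)
Lemma sum_decay_high (L M : nat) :
  \sum_(n : modes M | high L n) decay (freq R M n.1) * decay (freq R M n.2) <=
  40 / L.+1%:R.
Proof.
pose d (i : 'I_(2 * M).+1) := decay (freq R M i).
pose e (i : 'I_(2 * M).+1) := if L%:R < `|freq R M i| then d i else 0.
have d0 i : 0 <= d i by exact/ltW/decay_gt0.
have e0 i : 0 <= e i by rewrite /e; case: ifP.
have S5 : \sum_i d i <= 5 by exact: sum_decay.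
have T4 : \sum_i e i <= 4 / L.+1%:R by rewrite /e -big_mkcond; exact: sum_decay_tail.
have le1 : \sum_(n : modes M | high L n) d n.1 * d n.2 <=
    \sum_(n : modes M) (e n.1 * d n.2 + d n.1 * e n.2).
  rewrite big_mkcond; apply: ler_sum => n _; rewrite /high /e.
  case: ifP => [|_]; last by rewrite addr_ge0 ?mulr_ge0//; case: ifP.
  case: (L%:R < `|freq R M n.1|); case: (L%:R < `|freq R M n.2|) => //= _.
  - by rewrite lerDl mulr_ge0.
  - by rewrite mulr0 addr0.
  - by rewrite mul0r add0r.
apply: le_trans le1 _; rewrite big_split/= !sum_modes_prod.
have s0 : 0 <= \sum_i d i by rewrite sumr_ge0.
have t0 : 0 <= \sum_i e i by rewrite sumr_ge0.
have := ler_pM t0 s0 T4 S5; rewrite [(\sum_i d i) * _]mulrC.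
by move: (_ * \sum_i d i) (L.+1%:R^-1) => a b; lra.
Qed.

(** Each low mode has weight [(1 + L^2) * decay >= 1] in both coordinates, so [sum_decay] bounds the
    count independently of [M]. *)
Lemma count_low (L M : nat) :
  \sum_(n : modes M | ~~ high L n) (1 : R) <= ((1 + L%:R ^+ 2) * 5) ^+ 2.
Proof.
pose d (i : 'I_(2 * M).+1) := decay (freq R M i).
have d0 i : 0 <= d i by exact/ltW/decay_gt0.
have S5 : \sum_i d i <= 5 by exact: sum_decay.
have s0 : 0 <= \sum_i d i by rewrite sumr_ge0.
have L0 : 0 <= 1 + L%:R ^+ 2 :> R by rewrite addr_ge0 ?sqr_ge0.
have low (i : 'I_(2 * M).+1) : `|freq R M i| <= L%:R -> 1 <= (1 + L%:R ^+ 2) * d i.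
  move=> fL; rewrite /d /decay ler_pdivlMr ?ltr_wpDr ?sqr_ge0// mul1r lerD2l.
  by rewrite -[leLHS]real_normK ?num_real// lerXn2r ?nnegrE.
pose q i := (1 + L%:R ^+ 2) * d i.
have q0 i : 0 <= q i by rewrite mulr_ge0.
apply: (@le_trans _ _ (\sum_(n : modes M) q n.1 * q n.2)).
  rewrite big_mkcond; apply: ler_sum => n _; case: ifP => [|_]; last exact: mulr_ge0.
  rewrite /high negb_or -!leNgt => /andP[/low h1 /low h2].
  by rewrite -[leLHS]mul1r; apply: ler_pM.
rewrite sum_modes_prod /q -mulr_sumr -expr2.
by rewrite lerXn2r ?nnegrE ?mulr_ge0// ler_wpM2l.
Qed.

(** What is kept of the discrete solutions: bounds whose constants [K] and [W] do not depend on the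
    mesh. *)
Definition admissible (M : nat) (k : R * R) (c : modes M -> R[i]%C) : Prop :=
  [/\ K <= M%:R, `|k.1| <= K, `|k.2| <= K, \sum_n cabs (c n) ^+ 2 = 1 &
      \sum_n symbol M (wave k n) ^+ 2 * cabs (c n) ^+ 2 <= W ^+ 2].

Lemma cabs_coef_le1 (M : nat) (c : modes M -> R[i]%C) n :
  \sum_n cabs (c n) ^+ 2 = 1 -> cabs (c n) <= 1.
Proof.
move=> c1; rewrite -(@ler_pXn2r _ 2)// ?nnegrE ?cabs_ge0// expr1n -c1 (bigD1 n)//=.
by rewrite lerDl sumr_ge0// => m _; exact: sqr_ge0.
Qed.

(* [2 |c_n| <= s w_n^2 |c_n|^2 + 1 / (s w_n^2)], and [1 / w_n^2] is summable. *)
Lemma coef_tail (eta : R) : 0 < eta -> exists L : nat, forall M k (c : modes M -> R[i]%C),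
  admissible k c -> \sum_(n | high L n) cabs (c n) <= eta.
Proof.
(* The weight makes the energy part [s W^2] at most [eta]; the choice of [L] does the same for the
   other part, and the factor [1/2] averages the two. *)
move=> eta0; pose s := eta / (W ^+ 2 + 1).
have W0 : 0 < W ^+ 2 + 1 by rewrite ltr_wpDl// sqr_ge0.
have s0 : 0 < s by rewrite divr_gt0.
have cst0 := sym_cst_gt0 R; set C := sym_cst R in cst0.
have sC0 : 0 < s * C ^+ 2 by rewrite mulr_gt0// exprn_gt0.
(* Beyond [K] the lower bound on the symbol applies; beyond the second term, the tail bound [40 / L]
   divided by [s C^2] is at most [eta]. *)
pose L := Num.truncn (Num.max K (40 / (eta * (s * C ^+ 2)))); exists L.+1.
have LK : K < L.+1%:R by apply: le_lt_trans (truncnS_gt _); rewrite le_max lexx.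
have Le : 40 / (eta * (s * C ^+ 2)) < L.+1%:R.
  by apply: le_lt_trans (truncnS_gt _); rewrite le_max lexx orbT.
move=> M k c [KM k1 k2 c1 cW].
have term n : high L.+1 n -> cabs (c n) <=
    2^-1 * (s * (symbol M (wave k n) ^+ 2 * cabs (c n) ^+ 2) +
    (s * C ^+ 2)^-1 * (decay (freq R M n.1) * decay (freq R M n.2))).
  move=> hn; have := @symbol_ge R M K K1 KM k n k1 k2 _; rewrite -/C.
  set w := symbol M _; set D := decay _ * decay _ => /(_ _)/[dup] hD.
  have {}hD : C ^+ 2 <= w ^+ 2 * D.
    by apply: hD; case/orP: hn => h; apply/orP; [left|right]; exact: lt_trans h.
  move=> _; set x := cabs (c n).
  have D0 : 0 < D by rewrite mulr_gt0 ?decay_gt0.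
  have C2 : 0 < C ^+ 2 by rewrite exprn_gt0.
  have : x ^+ 2 <= (s * (w ^+ 2 * x ^+ 2)) * ((s * C ^+ 2)^-1 * D).
    rewrite (_ : _ * _ = x ^+ 2 * (w ^+ 2 * D / C ^+ 2)); last by field; lra.
    by rewrite ler_peMr ?sqr_ge0// ler_pdivlMr// mul1r.
  have u0 : 0 <= s * (w ^+ 2 * x ^+ 2) by apply: mulr_ge0; [exact: ltW|apply: mulr_ge0; exact: sqr_ge0].
  have v0 : 0 <= (s * C ^+ 2)^-1 * D by apply: mulr_ge0; [rewrite invr_ge0|]; exact: ltW.
  have x0 : 0 <= x := cabs_ge0 _.
  set u := s * (_ * _) in u0 *; set v := _^-1 * D in v0 *.
  move=> xuv; have uv0 : 0 <= 2^-1 * (u + v) by rewrite mulr_ge0// addr_ge0.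
  rewrite -(@ler_pXn2r _ 2)//; apply: le_trans xuv _.
  have := sqr_ge0 (u - v); lra.
apply: (@le_trans _ _ (\sum_(n | high L.+1 n)
    2^-1 * (s * (symbol M (wave k n) ^+ 2 * cabs (c n) ^+ 2) +
    (s * C ^+ 2)^-1 * (decay (freq R M n.1) * decay (freq R M n.2))))).
  exact: ler_sum.
rewrite -mulr_sumr big_split/= -!mulr_sumr.
have t1 : \sum_(n | high L.+1 n) symbol M (wave k n) ^+ 2 * cabs (c n) ^+ 2 <= W ^+ 2.
  apply: le_trans cW; rewrite big_mkcond; apply: ler_sum => n _.
  by case: ifP => // _; rewrite mulr_ge0// sqr_ge0.
have t2 := sum_decay_high L.+1 M.
have h1 : s * \sum_(n | high L.+1 n) symbol M (wave k n) ^+ 2 * cabs (c n) ^+ 2 <= eta.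
  apply: le_trans (ler_wpM2l (ltW s0) t1) _.
  by rewrite /s mulrAC ler_pdivrMr// ler_pM2l// lerDl.
have h2 : (s * C ^+ 2)^-1 * (\sum_(n : modes M | high L.+1 n)
    decay (freq R M n.1) * decay (freq R M n.2)) <= eta.
  apply: le_trans (ler_wpM2l _ t2) _; first by rewrite invr_ge0 ltW.
  rewrite ler_pdivrMl// ler_pdivrMr ?ltr0n//.
  have z0 := mulr_gt0 eta0 sC0; move: Le.
  rewrite (ltr_pdivrMr _ _ z0) => /ltW h; apply: le_trans h _.
  move: z0; rewrite [_ * eta]mulrC; set z := eta * _ => z0.
  by rewrite mulrC ler_pM2l// ler_nat.
lra.
Qed.

(** Finitely many low modes with coefficients at most 1, plus a tail of total size at most 1. *)
Lemma bloch_bounded : exists A : R, forall M k (c : modes M -> R[i]%C),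
  admissible k c -> forall x, cabs (bloch k c x) <= A.
Proof.
have [L hL] := coef_tail ltr01.
exists (((1 + L%:R ^+ 2) * 5) ^+ 2 + 1) => M k c ac x.
apply: le_trans (cabs_sum _ _ _) _.
under eq_bigr do rewrite Normc.normcM cabs_cis mulr1.
rewrite (bigID (fun n => ~~ high L n))/=; apply: lerD.
  apply: le_trans (count_low L M); apply: ler_sum => n _.
  by case: ac => _ _ _ c1 _; exact: cabs_coef_le1.
by under eq_bigl do rewrite negbK; exact: hL ac.
Qed.

Lemma bloch_equicontinuous (eta : R) : 0 < eta -> exists2 rho : R, 0 < rho &
  forall M k (c : modes M -> R[i]%C), admissible k c ->
  forall x y, `|x - y| < rho -> cabs (bloch k c x - bloch k c y) <= eta.
Proof.
move=> eta0; have eta4 : 0 < eta / 4 by rewrite divr_gt0.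
have [L hL] := coef_tail eta4.
pose H : R := ((1 + L%:R ^+ 2) * 5) ^+ 2.
(* A Lipschitz constant of the low plane waves: a factor 2 from [cis_lip] and a factor 2 for the two
   coordinates. *)
pose V := 4 * (K + 2 * pi * L%:R).
have V0 : 0 < V.
  have h : 0 <= 2 * pi * L%:R :> R by rewrite !mulr_ge0 ?pi_ge0.
  by rewrite /V mulr_gt0// ltr_pwDl// (lt_le_trans ltr01).
have H0 : 0 < H by rewrite exprn_gt0// mulr_gt0// ltr_pwDl ?sqr_ge0.
have HV0 := mulr_gt0 H0 V0.
(* The at most [H] low modes contribute [eta / 2]; the tail contributes twice [eta / 4]. *)
exists (eta / (2 * (H * V))); first by rewrite divr_gt0// mulr_gt0.
move=> M k c ac x y xy; have [KM k1 k2 c1 _] := ac.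
rewrite /bloch -sumrB; apply: le_trans (cabs_sum _ _ _) _.
rewrite (bigID (fun n => ~~ high L n))/=.
have -> : eta = eta / 2 + eta / 2 by lra.
apply: lerD.
  apply: (@le_trans _ _ (\sum_(n : modes M | ~~ high L n) (V * `|x - y|) * 1)).
    apply: ler_sum => n; rewrite /high negb_or -!leNgt => /andP[f1 f2].
    rewrite -mulrBr Normc.normcM mulr1 -[leRHS]mul1r.
    apply: ler_pM; [exact: cabs_ge0|exact: cabs_ge0|exact: cabs_coef_le1|].
    apply: le_trans (cis_lip _ _) _.
    have comp (kj f d : R) : `|kj| <= K -> `|f| <= L%:R -> `|d| <= `|x - y| ->
        `|(kj + 2 * pi * f) * d| <= (K + 2 * pi * L%:R) * `|x - y|.
      move=> h1 h2 h3; rewrite normrM; apply: ler_pM => //.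
      apply: le_trans (ler_normD _ _) _; apply: lerD => //.
      by rewrite !normrM (ger0_norm (@pi_ge0 R)) [`|2|]ger0_norm// ler_wpM2l// mulr_ge0 ?pi_ge0.
    have d1 : `|x.1 - y.1| <= `|x - y| by rewrite [leRHS]prod_normE/= le_max lexx.
    have d2 : `|x.2 - y.2| <= `|x - y| by rewrite [leRHS]prod_normE/= le_max lexx orbT.
    rewrite (_ : _ - _ = (wave k n).1 * (x.1 - y.1) + (wave k n).2 * (x.2 - y.2)); last by ring.
    have := ler_normD ((wave k n).1 * (x.1 - y.1)) ((wave k n).2 * (x.2 - y.2)).
    have := comp _ _ _ k1 f1 d1; have := comp _ _ _ k2 f2 d2; rewrite /V /wave/=; lra.
  rewrite -mulr_sumr.
  apply: le_trans (ler_wpM2l _ (count_low L M)) _; first by rewrite mulr_ge0// ltW.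
  rewrite -/H; move: xy; rewrite ltr_pdivlMr; last by rewrite mulr_gt0.
  by clearbody V H; move: `|x - y| => d; lra.
under eq_bigl do rewrite negbK.
apply: (@le_trans _ _ (\sum_(n : modes M | high L n) 2 * cabs (c n))); last first.
  by rewrite -mulr_sumr; have := hL _ _ _ ac; lra.
apply: ler_sum => n _; rewrite -mulrBr Normc.normcM mulrC ler_wpM2r ?cabs_ge0//.
have := ler_normB (plane_wave (wave k n) x) (plane_wave (wave k n) y).
by rewrite !cabsE !cabs_cis -rmorphD lecR.
Qed.

End BlochEstimates.

(** * Crossing of the zero mode *)

Section Crossing.
Variable R : realType.
Implicit Types (k : R * R) (lam eta : R).

(** The symbol of minus the continuous Laplacian at the mode [(a, b)], the limit of [symbol] as the
    mesh shrinks. *)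
Definition disp k (a b : int) : R :=
  (k.1 + 2 * pi * a%:~R) ^+ 2 + (k.2 + 2 * pi * b%:~R) ^+ 2.

(* Along the segment from [k0] to [k1] only the mode [(0, 0)] crosses [lam]. *)
Definition crossing lam eta k0 k1 : Prop :=
  [/\ disp k0 0 0 < lam - eta, lam + eta < disp k1 0 0 &
      forall a b : int, (a, b) != (0, 0) ->
        (disp k0 a b < lam - eta /\ disp k1 a b < lam - eta) \/
        (lam + eta < disp k0 a b /\ lam + eta < disp k1 a b)].

Lemma freqE (M i : nat) : freq R M i = (i%:Z - M%:Z)%:~R.
Proof. by rewrite intrB. Qed.

Lemma ltn_double_succ (M : nat) : (M < (2 * M).+1)%N.
Proof. by rewrite ltnS leq_pmull. Qed.

(** With [t = xi / N], [4 sin^2 (t / 2)] lies between [t^2 cos^4 (t / 4)] and [t^2], and [1 - cos^4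
    (t / 4) <= 4 (1 - cos (t / 4)) <= |t|]. The error is thus at most [xi^2 |t| <= B^3 / N]. *)
Lemma symbol1_approx (N : nat) (xi B : R) : (0 < N)%N -> `|xi| <= B ->
  B <= N%:R ->
  xi ^+ 2 - B ^+ 3 / N%:R <= N%:R ^+ 2 * (2 - 2 * cos (xi / N%:R)) <= xi ^+ 2.
Proof.
move=> N0 xB BN; have N0' : (0 : R) < N%:R by rewrite ltr0n.
set t := xi / N%:R.
have xiE : xi = N%:R * t by rewrite /t mulrCA divff ?mulr1// gt_eqF.
rewrite two_sub_2cos; have N2 : (0 : R) < N%:R ^+ 2 by rewrite exprn_gt0.
have tB : `|t| <= B / N%:R by rewrite normrM normfV (ger0_norm (ltW N0')) ler_pM2r ?invr_gt0.
have t1 : `|t| <= 1 by rewrite (le_trans tB)// ler_pdivrMr// mul1r.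
have pi2 := @pi_ge2 R.
have /sin_sqr_ge hge : `|t / 2| <= pi by rewrite normrM [`|2^-1|]ger0_norm//; lra.
have hle := sin_sqr_le (t / 2).
have e : t / 2 / 2 = t / 4 by lra.
rewrite e in hge; set c := cos (t / 4) in hge.
have c1 : c <= 1 by exact: cos_le1.
have clip : 1 - c <= `|t| / 4.
  have := cos_lip 0 (t / 4); rewrite cos0 sub0r normrN normrM [`|4^-1|]ger0_norm//.
  by apply: le_trans; exact: ler_norm.
have t0 := normr_ge0 t.
have c0 : 0 <= c by lra.
have c4 : 1 - `|t| <= c ^+ 4.
  have : (1 - c) * ((1 + c) * (1 + c ^+ 2)) <= (1 - c) * 4 by apply: ler_wpM2l; nra.
  rewrite (_ : _ * ((1 + c) * _) = 1 - c ^+ 4); last by ring.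
  lra.
apply/andP; split; last first.
  by rewrite [leRHS](_ : _ = N%:R ^+ 2 * (4 * (t / 2) ^+ 2)); [nra|rewrite xiE; field].
apply: (@le_trans _ _ (N%:R ^+ 2 * (t ^+ 2 * c ^+ 4))); last by nra.
apply: (@le_trans _ _ (xi ^+ 2 * (1 - `|t|))).
  rewrite mulrBr mulr1 lerD2l lerN2 (exprSr B) -mulrA.
  apply: ler_pM => //; first exact: sqr_ge0.
  by rewrite -[leLHS]real_normK ?num_real// lerXn2r ?nnegrE// (le_trans _ xB).
by rewrite {1}xiE exprMn -mulrA ler_pM2l// ler_wpM2l ?sqr_ge0.
Qed.

Lemma prod_gt0_same_side lam (v x y : R) : 0 <= v ->
  (x < lam - v /\ y < lam - v) \/ (lam + v < x /\ lam + v < y) ->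
  0 < (x - lam) * (y - lam).
Proof.
by move=> v0 [[? ?]|[? ?]]; [rewrite nmulr_rgt0|rewrite mulr_gt0]; lra.
Qed.

Lemma prod_lt0_opp_side lam (v x y : R) : 0 <= v -> x < lam - v -> lam + v < y ->
  (x - lam) * (y - lam) < 0.
Proof. by move=> v0 ? ?; rewrite nmulr_rlt0; lra. Qed.

Lemma norm_gt_off (lam v w : R) : (w < lam - v) \/ (lam + v < w) -> v < `|w - lam|.
Proof. by case=> h; rewrite lter_normr; apply/orP; [right|left]; lra. Qed.

(** Coercivity puts high modes above [lam + v]; at low modes the symbol converges uniformly, and the
    slack [eta - v] absorbs the error. Only the zero mode then contributes a negative factor. *)
Lemma crossing_symbol lam eta k0 k1 (v K : R) : 1 <= K ->
  `|k0.1| <= K -> `|k0.2| <= K -> `|k1.1| <= K -> `|k1.2| <= K ->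
  0 <= lam -> 0 <= v -> v < eta -> crossing lam eta k0 k1 ->
  exists M0 : nat, forall M, (M0 <= M)%N ->
    let T := ('I_(2 * M).+1 * 'I_(2 * M).+1)%type in
    [/\ forall n : T, v < `|symbol M (wave k0 n) - lam|,
        forall n : T, v < `|symbol M (wave k1 n) - lam| &
        (\prod_(n : T) (symbol M (wave k0 n) - lam)) *
        (\prod_(n : T) (symbol M (wave k1 n) - lam)) < 0].
Proof.
move=> K1 h01 h02 h11 h12 lam0 v0 veta [c0 c1 cn].
have C0 := sym_cst_gt0 R; set C := sym_cst R in C0.
(* Chosen so that [C * L.+1 > lam + v], the lower bound for the symbol at high modes. *)
pose L := Num.truncn (Num.max K ((lam + v) / C)).
have LK : K < L.+1%:R by apply: le_lt_trans (truncnS_gt _); rewrite le_max lexx.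
have LC : (lam + v) / C < L.+1%:R.
  by apply: le_lt_trans (truncnS_gt _); rewrite le_max lexx orbT.
pose B := K + 2 * pi * L.+1%:R.
have B1 : 1 <= B.
  have h : 0 <= 2 * pi * L.+1%:R :> R by rewrite !mulr_ge0 ?pi_ge0.
  by rewrite (le_trans K1)// /B lerDl.
have ev : 0 < eta - v by rewrite subr_gt0.
(* Ensures [K < M] for coercivity, [B < N] for the expansion, and a total error [2 B^3 / N] of the
   two coordinates below [eta - v]. *)
pose M0 := (Num.truncn (Num.max (Num.max K B) (2 * B ^+ 3 / (eta - v)))).+1.
exists M0 => M MM T.
have Mlt x : x <= Num.max (Num.max K B) (2 * B ^+ 3 / (eta - v)) -> x < M%:R.
  move=> h; apply: (@lt_le_trans _ _ M0%:R); last by rewrite ler_nat.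
  exact: le_lt_trans h (truncnS_gt _).
have MK : K < M%:R by apply: Mlt; rewrite !le_max lexx.
have MN : M%:R <= (2 * M).+1%:R :> R by rewrite ler_nat ltnW// ltn_double_succ.
have NB : B < (2 * M).+1%:R.
  by apply: lt_le_trans MN; apply: Mlt; rewrite !le_max lexx orbT.
have NE : 2 * B ^+ 3 / (2 * M).+1%:R < eta - v.
  rewrite ltr_pdivrMr ?ltr0n// [ltRHS]mulrC -ltr_pdivrMr//.
  by apply: lt_le_trans MN; apply: Mlt; rewrite !le_max lexx !orbT.
pose dn k (n : T) := disp k (n.1%:Z - M%:Z) (n.2%:Z - M%:Z).
have hiP k (n : T) : `|k.1| <= K -> `|k.2| <= K ->
    (L.+1%:R < `|freq R M n.1|) || (L.+1%:R < `|freq R M n.2|) ->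
    lam + v < symbol M (wave k n).
  move=> hk1 hk2 hn; set w := symbol M _.
  have w0 : 0 <= w.
    by rewrite /w /symbol mulr_ge0 ?sqr_ge0//;
      have := one_sub_cos_ge0 ((wave k n).1 / (2 * M).+1%:R);
      have := one_sub_cos_ge0 ((wave k n).2 / (2 * M).+1%:R); lra.
  have := @symbol_ge R M K K1 (ltW MK) k n hk1 hk2.
  rewrite -/C -/w => h.
  have {h} hw : C ^+ 2 <= w ^+ 2 * (decay (freq R M n.1) * decay (freq R M n.2)).
    by apply: h; case/orP: hn => h; apply/orP; [left|right]; exact: lt_trans h.
  have d1 x : decay (x : R) <= 1 by rewrite invf_le1 ?ltr_wpDr ?sqr_ge0// lerDl sqr_ge0.
  have d0 x : 0 <= decay (x : R) by exact/ltW/decay_gt0.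
  have dL x : L.+1%:R < `|x| -> decay (x : R) * L.+1%:R ^+ 2 <= 1.
    move=> hx; rewrite /decay mulrC ler_pdivrMr ?ltr_wpDr ?sqr_ge0// mul1r.
    rewrite -[x ^+ 2]real_normK ?num_real// (le_trans _ (_ : `|x| ^+ 2 <= _))//.
      by rewrite lerXn2r ?nnegrE// ltW.
    by rewrite lerDr.
  have hL : (decay (freq R M n.1) * decay (freq R M n.2)) * L.+1%:R ^+ 2 <= 1.
    case/orP: hn => /dL hd.
      by rewrite mulrAC -[leRHS]mul1r; apply: ler_pM => //; rewrite mulr_ge0 ?sqr_ge0.
    by rewrite -mulrA -[leRHS]mul1r; apply: ler_pM => //; rewrite mulr_ge0 ?sqr_ge0.
  have : (C * L.+1%:R) ^+ 2 <= w ^+ 2.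
    rewrite exprMn; apply: (le_trans (ler_wpM2r (sqr_ge0 _) hw)).
    by rewrite -mulrA -[leRHS]mulr1 ler_wpM2l ?sqr_ge0.
  have CL0 : 0 <= C * L.+1%:R := mulr_ge0 (ltW C0) (ler0n _ _).
  rewrite ler_pXn2r// => hCL; apply: lt_le_trans hCL.
  by rewrite mulrC -ltr_pdivrMr.
have loP k (n : T) : `|k.1| <= K -> `|k.2| <= K ->
    ~~ ((L.+1%:R < `|freq R M n.1|) || (L.+1%:R < `|freq R M n.2|)) ->
    dn k n - (eta - v) < symbol M (wave k n) <= dn k n.
  move=> hk1 hk2; rewrite negb_or -!leNgt => /andP[f1 f2].
  have xb (kj f : R) : `|kj| <= K -> `|f| <= L.+1%:R -> `|kj + 2 * pi * f| <= B.
    move=> h1 h2; apply: le_trans (ler_normD _ _) _; apply: lerD => //.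
    by rewrite !normrM (ger0_norm (@pi_ge0 R)) [`|2|]ger0_norm// ler_wpM2l// mulr_ge0 ?pi_ge0.
  have /andP[l1 u1] := symbol1_approx (ltn0Sn (2 * M)) (xb _ _ hk1 f1) (ltW NB).
  have /andP[l2 u2] := symbol1_approx (ltn0Sn (2 * M)) (xb _ _ hk2 f2) (ltW NB).
  have S : symbol M (wave k n) =
    (2 * M).+1%:R ^+ 2 * (2 - 2 * cos ((k.1 + 2 * pi * freq R M n.1) / (2 * M).+1%:R)) +
    (2 * M).+1%:R ^+ 2 * (2 - 2 * cos ((k.2 + 2 * pi * freq R M n.2) / (2 * M).+1%:R)).
    by rewrite /symbol /wave /=; ring.
  rewrite S /dn /disp -!freqE; move: NE l1 u1 l2 u2; rewrite -mulrA.
  move: (B ^+ 3 / _) (_ * (2 - _)) (_ * (2 - _)) ((_ + _) ^+ 2) ((_ + _) ^+ 2).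
  by move=> ? ? ? ? ? ? ? ? ? ?; apply/andP; split; lra.
have up k (n : T) : `|k.1| <= K -> `|k.2| <= K -> lam + eta < dn k n ->
    lam + v < symbol M (wave k n).
  move=> hk1 hk2 hd.
  case: (boolP ((L.+1%:R < `|freq R M n.1|) || (L.+1%:R < `|freq R M n.2|))) => hn.
    exact: hiP.
  by have /andP[] := loP k n hk1 hk2 hn; lra.
have down k (n : T) : `|k.1| <= K -> `|k.2| <= K -> dn k n < lam - eta ->
    symbol M (wave k n) < lam - v.
  move=> hk1 hk2 hd.
  have -> : symbol M (wave k n) =
    (2 * M).+1%:R ^+ 2 * (2 - 2 * cos ((k.1 + 2 * pi * freq R M n.1) / (2 * M).+1%:R)) +
    (2 * M).+1%:R ^+ 2 * (2 - 2 * cos ((k.2 + 2 * pi * freq R M n.2) / (2 * M).+1%:R)).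
    by rewrite /symbol /wave /=; ring.
  (* From [sin^2 y <= y^2]: the discrete symbol lies below the continuous one at every frequency. *)
  have hs (xi : R) : (2 * M).+1%:R ^+ 2 * (2 - 2 * cos (xi / (2 * M).+1%:R)) <= xi ^+ 2.
    rewrite two_sub_2cos; have := sin_sqr_le (xi / (2 * M).+1%:R / 2).
    rewrite (_ : xi ^+ 2 = (2 * M).+1%:R ^+ 2 * (4 * (xi / (2 * M).+1%:R / 2) ^+ 2)).
      by move=> h; rewrite ler_wpM2l ?sqr_ge0// ler_pM2l.
    have : (2 * M).+1%:R != 0 :> R by rewrite pnatr_eq0.
    by move: ((2 * M).+1%:R : R) => N N0; field.
  have := hs (k.1 + 2 * pi * freq R M n.1); have := hs (k.2 + 2 * pi * freq R M n.2).
  move: hd; rewrite /dn /disp -!freqE.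
  by move: (_ * (2 - _)) (_ * (2 - _)) ((_ + _) ^+ 2) ((_ + _) ^+ 2) => ? ? ? ?; lra.
have MT := ltn_double_succ M.
(* The index [M] stands for frequency 0. *)
pose z : T := (Ordinal MT, Ordinal MT).
have dz k : dn k z = disp k 0 0 by rewrite /dn /= subrr.
have z0 := down k0 z h01 h02; have z1 := up k1 z h11 h12.
rewrite !dz in z0 z1; have {}z0 := z0 c0; have {}z1 := z1 c1.
have nz (n : T) : n != z ->
    (symbol M (wave k0 n) < lam - v /\ symbol M (wave k1 n) < lam - v) \/
    (lam + v < symbol M (wave k0 n) /\ lam + v < symbol M (wave k1 n)).
  move=> nz; have := cn (n.1%:Z - M%:Z) (n.2%:Z - M%:Z).
  case=> [|[? ?]|[? ?]].
  - apply: contra nz => /eqP[]/eqP; rewrite subr_eq0 => /eqP[e1] /eqP.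
    rewrite subr_eq0 => /eqP[e2].
    by rewrite /z; case: n e1 e2 => [[a ha] [b hb]] /= e1 e2; apply/eqP; congr (_, _);
      apply: val_inj.
  - by left; split; apply: down.
  - by right; split; apply: up.
split.
- move=> n; apply: norm_gt_off; have [->|/nz] := eqVneq n z; first by left.
  by move=> [[]|[]]; [left|right].
- move=> n; apply: norm_gt_off; have [->|/nz] := eqVneq n z; first by right.
  by move=> [[]|[]]; [left|right].
rewrite -big_split/= (bigD1 z)//=.
have p1 : 0 < \prod_(n : T | n != z)
    ((symbol M (wave k0 n) - lam) * (symbol M (wave k1 n) - lam)).
  by apply: prodr_gt0 => n /nz; exact: prod_gt0_same_side.
by rewrite pmulr_llt0//; exact: prod_lt0_opp_side z0 z1.
Qed.

(** The quasimomentum found on each grid varies, but it lies on the segment from [k0] to [k1], so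
    all Bloch sums obey the estimates with the same [K] and [W]. *)
Lemma crossing_solution (eps : R * R -> R) lam eta k0 k1 (v : R) :
  continuous eps -> Z2_periodic eps -> (forall x, `|lam * eps x - lam| <= v) ->
  0 <= lam -> v < eta -> crossing lam eta k0 k1 ->
  exists E : R * R -> R[i]%C,
    [/\ cbounded E, nonzero E & distributional_solution eps lam E].
Proof.
move=> ceps peps heps lam0 veta cr.
have v0 : 0 <= v by apply: le_trans (heps 0).
pose K := 1 + (`|k0.1| + `|k0.2| + `|k1.1| + `|k1.2|).
have nk (x : R) := normr_ge0 x.
have K1 : 1 <= K by rewrite /K lerDl !addr_ge0.
have := (nk k0.1, nk k0.2, nk k1.1, nk k1.2) => -[[[n1 n2] n3] n4].
have h01 : `|k0.1| <= K by rewrite /K; lra.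
have h02 : `|k0.2| <= K by rewrite /K; lra.
have h11 : `|k1.1| <= K by rewrite /K; lra.
have h12 : `|k1.2| <= K by rewrite /K; lra.
have [M0 hM0] := crossing_symbol K1 h01 h02 h11 h12 lam0 v0 veta cr.
pose kf t : R * R := (k0.1 + t * (k1.1 - k0.1), k0.2 + t * (k1.2 - k0.2)).
have ckf1 : continuous (fun t => (kf t).1).
  by move=> t; apply: cvgD; [exact: cvg_cst|apply: cvgM; [exact: cvg_id|exact: cvg_cst]].
have ckf2 : continuous (fun t => (kf t).2).
  by move=> t; apply: cvgD; [exact: cvg_cst|apply: cvgM; [exact: cvg_id|exact: cvg_cst]].
have kf0 : kf 0 = k0 by rewrite /kf !mul0r !addr0; case: (k0).
have kf1 : kf 1 = k1 by rewrite /kf !mul1r [k0.1 + _]addrC [k0.2 + _]addrC !subrK; case: (k1).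
have segK (x y t : R) : 0 <= t <= 1 -> `|x| <= K -> `|y| <= K -> `|x + t * (y - x)| <= K.
  move=> /andP[t0 t1]; rewrite !ler_norml => /andP[? ?] /andP[? ?].
  by apply/andP; split; nra.
pose W := `|lam| + v.
pose MK := Num.truncn K.
(* The three terms secure the sign change, [K <= M], and a mesh number growing beyond [m]. *)
pose Mm m := (M0 + MK.+1 + m)%N.
have [A hA] := @bloch_bounded R K W K1.
have ex m : exists G : R * R -> R[i]%C,
    [/\ exists k c, admissible K W (M := Mm m) k c /\ G = bloch k c,
        exists2 x, `|x| <= 1 & 1 <= cabs (G x) &
        forall a b : int,
          let z := (a%:~R / (2 * Mm m).+1%:R, b%:~R / (2 * Mm m).+1%:R) in
          dlap (2 * Mm m).+1%:R^-1 (re_part G) z =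
            - ((2 * Mm m).+1%:R^-1 ^+ 2 * ((lam * eps z) * re_part G z)) /\
          dlap (2 * Mm m).+1%:R^-1 (im_part G) z =
            - ((2 * Mm m).+1%:R^-1 ^+ 2 * ((lam * eps z) * im_part G z))].
  have [|g0 g1 gp] := hM0 (Mm m); first by rewrite /Mm -addnA leq_addr.
  have [|||t [t01 [c [cc1 cW mass eq]]]] :=
    @discrete_bloch R (Mm m) eps lam v kf peps heps ckf1 ckf2.
  - by rewrite kf0.
  - by rewrite kf1.
  - by rewrite kf0 kf1.
  exists (bloch (kf t) c); split => //; exists (kf t), c; split => //; split => //.
  - apply: le_trans (ltW (truncnS_gt K)) _; rewrite ler_nat.
    exact: leq_trans (leq_addl M0 MK.+1) (leq_addr m _).
  - exact: segK.
  - exact: segK.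
have /choice[G hG] := ex.
apply: (@limit_solution R eps lam A G (fun m => (2 * Mm m).+1)) => //.
- by move=> m; apply: leq_ltn_trans (ltn_double_succ _); rewrite /Mm leq_addl.
- by move=> m x; have [[k [c [ac ->]]] _ _] := hG m; exact: hA.
- move=> eta' eta0; have [rho rho0 h] := @bloch_equicontinuous R K W K1 eta' eta0.
  exists rho => // m x y xy; have [[k [c [ac ->]]] _ _] := hG m.
  exact: h xy.
- by move=> m; have [_ ? _] := hG m.
- by move=> m a b; have [_ _ h] := hG m; exact: h.
Qed.

(** No crossing exists at [lambda = 0], since energies are nonnegative. The constant 1 solves every
    discrete equation there, and the limit argument spares a separate integration by parts. *)
Lemma constant_solution (eps : R * R -> R) : continuous eps ->
  exists E : R * R -> R[i]%C,
    [/\ cbounded E, nonzero E & distributional_solution eps 0 E].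
Proof.
move=> ceps.
apply: (@limit_solution R eps 0 1 (fun _ _ => 1) (fun m => m.+1)) => //.
- by move=> m x; rewrite Normc.normc1.
- by move=> eta eta0; exists 1 => // m x y _; rewrite subrr Normc.normc0 ltW.
- by move=> m; exists 0; rewrite ?normr0// Normc.normc1.
- by move=> m a b z; rewrite /dlap /re_part /im_part !mul0r mulr0 oppr0; split => /=; lra.
Qed.

End Crossing.

(** * Choice of the quasimomenta *)

Section ChoiceOfQuasimomenta.
Variable R : realType.
Implicit Types (lam eta : R).

Lemma poly_nonroot (p : {poly R}) : p != 0 -> exists s, p.[s] != 0.
Proof.
move=> p0; apply: contrapT => h.
have := @max_poly_roots _ p [seq i%:R | i <- iota 0 (size p)] p0 _ _.
rewrite size_map size_iota ltnn => H; apply: notF; apply: H.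
  apply/allP => x _; apply: contrapT => nx; apply: h; exists x; exact/negP.
by rewrite map_inj_uniq ?iota_uniq// => i j /eqP; rewrite eqr_nat => /eqP.
Qed.

(** The constant [1 / (1 + sum 1 / |f n|)] lies below every [|f n|] and stays positive when [P]
    selects nothing. *)
Lemma finite_gap (T : finType) (P : pred T) (f : T -> R) :
  (forall n, P n -> f n != 0) ->
  exists2 gam, 0 < gam & forall n, P n -> gam <= `|f n|.
Proof.
move=> f0; pose S := \sum_(n | P n) `|f n|^-1.
have S0 : 0 <= S by apply: sumr_ge0 => n _; rewrite invr_ge0.
exists (1 + S)^-1; first by rewrite invr_gt0 ltr_wpDr.
move=> n Pn; have fn : 0 < `|f n| by rewrite normr_gt0 f0.
rewrite -[leRHS]invrK lef_pV2 ?posrE ?invr_gt0 ?ltr_wpDr//.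
by rewrite /S (bigD1 n)//= addrCA lerDl addr_ge0// sumr_ge0.
Qed.

Lemma freq_eq0 (L : nat) (n : 'I_(2 * L).+1 * 'I_(2 * L).+1) :
  freq R L n.1 ^+ 2 + freq R L n.2 ^+ 2 = 0 ->
  n = (Ordinal (ltn_double_succ L), Ordinal (ltn_double_succ L)).
Proof.
move=> /eqP; rewrite paddr_eq0 ?sqr_ge0// !sqrf_eq0 /freq !subr_eq0 !eqr_nat.
case: n => [[a ha] [b hb]] /= /andP[/eqP ea /eqP eb].
by congr (_, _); apply: val_inj.
Qed.

(* Rational parametrization of the circle turns each excluded Bragg line into
   a nonzero polynomial condition. *)
Lemma generic_point (L : nat) lam : 0 < lam ->
  exists2 q : R * R, q.1 ^+ 2 + q.2 ^+ 2 = lam &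
  forall n : 'I_(2 * L).+1 * 'I_(2 * L).+1,
    n != (Ordinal (ltn_double_succ L), Ordinal (ltn_double_succ L)) ->
    (q.1 + 2 * pi * freq R L n.1) ^+ 2 + (q.2 + 2 * pi * freq R L n.2) ^+ 2 - lam != 0.
Proof.
move=> lam0; set z := (_, _); pose r := Num.sqrt lam.
have r2 : r ^+ 2 = lam by rewrite sqr_sqrtr// ltW.
pose nn (n : 'I_(2 * L).+1 * 'I_(2 * L).+1) := freq R L n.1 ^+ 2 + freq R L n.2 ^+ 2.
(* The excess energy of mode [n] over [lam] at the circle point with parameter [s], multiplied by
   [(1 + s^2) / (4 pi)]. *)
pose p (n : 'I_(2 * L).+1 * 'I_(2 * L).+1) : {poly R} := (r * freq R L n.1)%:P * (1 - 'X^2) +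
  (2 * r * freq R L n.2)%:P * 'X + (pi * nn n)%:P * (1 + 'X^2).
have pE n s : (p n).[s] = r * freq R L n.1 * (1 - s ^+ 2) + 2 * r * freq R L n.2 * s +
    pi * nn n * (1 + s ^+ 2).
  by rewrite /p !hornerE.
have p0 n : n != z -> p n != 0.
  move=> nz; apply: contra nz => /eqP pn0.
  (* At [1] and [-1] the term in [1 - s^2] vanishes and the linear terms cancel in the sum, leaving
     [4 pi |n|^2]. *)
  have e1 : (p n).[1] = 0 by rewrite pn0 horner0.
  have e2 : (p n).[-1] = 0 by rewrite pn0 horner0.
  apply/eqP/freq_eq0; rewrite -/(nn n).
  have : pi * nn n = 0 by move: e1 e2; rewrite !pE sqrrN; lra.
  by move/eqP; rewrite mulf_eq0 gt_eqF ?pi_gt0//= => /eqP.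
have [|s hs] := @poly_nonroot (\prod_(n | n != z) p n).
  by apply/prodf_neq0 => n; exact: p0.
have s0 : 0 < 1 + s ^+ 2 by rewrite ltr_wpDr ?sqr_ge0.
have s1 : 1 + s ^+ 2 != 0 by rewrite gt_eqF.
exists (r * (1 - s ^+ 2) / (1 + s ^+ 2), 2 * r * s / (1 + s ^+ 2)).
  by rewrite /= -r2; field.
move=> n nz /=; have : (p n).[s] != 0.
  by move: hs; rewrite horner_prod => /prodf_neq0; apply.
rewrite pE => hp.
rewrite (_ : _ - lam = 4 * pi / (1 + s ^+ 2) * (r * freq R L n.1 * (1 - s ^+ 2) +
  2 * r * freq R L n.2 * s + pi * nn n * (1 + s ^+ 2))); last first.
  by rewrite /nn -r2; field.
by rewrite mulf_neq0// mulf_neq0 ?invr_eq0// mulf_neq0 ?gt_eqF ?pi_gt0.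
Qed.

Lemma int_freq (L : nat) (a : int) : `|a%:~R : R| <= L%:R ->
  exists i : 'I_(2 * L).+1, freq R L i = a%:~R.
Proof.
move=> aL; have [aL1 aL2] : (- L%:Z <= a)%R /\ (a <= L%:Z)%R.
  by move: aL; rewrite ler_norml -[L%:R]/(L%:Z%:~R) -mulrNz !ler_int => /andP.
have h : (absz (a + L%:Z)%R < (2 * L).+1)%N.
  rewrite -ltz_nat gez0_abs; last by rewrite -lerBlDr sub0r.
  by rewrite -addn1 PoszD PoszM; lia.
exists (Ordinal h); rewrite freqE /= gez0_abs ?addrK//.
by rewrite -lerBlDr sub0r.
Qed.

Lemma gap_same_side (lam eta gam d d0 d1 : R) : 0 < gam -> eta <= gam / 4 ->
  gam <= `|d - lam| -> `|d0 - d| <= gam / 2 -> `|d1 - d| <= gam / 2 ->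
  (d0 < lam - eta /\ d1 < lam - eta) \/ (lam + eta < d0 /\ lam + eta < d1).
Proof.
move=> g0 he; rewrite !ler_norml => h /andP[? ?] /andP[? ?].
by move: h; rewrite ler_normr => /orP[h|h]; [right|left]; split; lra.
Qed.

(** Radial scaling by [1 + u] of a generic point [q] moves the zero mode through [lam]. Modes beyond
    [L] stay far above; the finitely many others are at distance at least [gam] at [u = 0] and move
    by at most [gam / 2]. *)
Lemma crossing_exists lam : 0 < lam ->
  exists k0 k1 eta, 0 < eta /\ crossing lam eta k0 k1.
Proof.
move=> lam0; pose r := Num.sqrt lam.
have r2 : r ^+ 2 = lam by rewrite sqr_sqrtr// ltW.
have r0 : 0 < r by rewrite sqrtr_gt0.
pose K := 2 * r + 1.
have K1 : 1 <= K by rewrite lerDr mulr_ge0// ltW.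
pose L := (Num.truncn (Num.max K (lam + 1))).+1.
have LK : K < L%:R by apply: le_lt_trans (truncnS_gt _); rewrite le_max lexx.
have Ll : lam + 1 < L%:R by apply: le_lt_trans (truncnS_gt _); rewrite le_max lexx orbT.
have [q q2 hq] := generic_point L lam0.
have [gam gam0 hgam] := finite_gap hq.
have pi0 := @pi_gt0 R.
have qr1 : `|q.1| <= r.
  rewrite -(@ler_pXn2r _ 2)// ?nnegrE ?(ltW r0)// real_normK ?num_real// r2 -q2.
  by rewrite lerDl sqr_ge0.
have qr2 : `|q.2| <= r.
  rewrite -(@ler_pXn2r _ 2)// ?nnegrE ?(ltW r0)// real_normK ?num_real// r2 -q2.
  by rewrite lerDr sqr_ge0.
(* Bounds the speed in [u] of the energies of modes up to [L]: [(2 + u) lam <= 3 lam], plus [4 pi]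
   times two products of size at most [L r]. *)
pose D := 3 * lam + 8 * pi * L%:R * r.
have D0 : 0 < D.
  by rewrite ltr_wpDr ?mulr_gt0// !mulr_ge0// ltW.
pose t := Num.min (1 / 2) (gam / (2 * D)).
have t0 : 0 < t by rewrite lt_min !divr_gt0// mulr_gt0.
have t1 : t <= 1 / 2 by rewrite ge_min lexx.
have tD : t * D <= gam / 2.
  apply: (@le_trans _ _ (gam / (2 * D) * D)).
    by rewrite ler_pM2r// ge_min lexx orbT.
  by rewrite invfM mulrA mulfVK// gt_eqF.
(* The three bounds serve the modes beyond [L], the remaining nonzero modes, and the zero mode,
   whose energy at both ends is at distance at least [lam * t] from [lam]. *)
pose eta := Num.min (1 / 2) (Num.min (gam / 4) (lam * t / 2)).
have eta0 : 0 < eta by rewrite !lt_min !divr_gt0// mulr_gt0.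
have eta1 : eta <= 1 / 2 by rewrite ge_min lexx.
have eta2 : eta <= gam / 4 by rewrite !ge_min lexx orbT.
have eta3 : eta <= lam * t / 2 by rewrite !ge_min lexx !orbT.
pose k u : R * R := ((1 + u) * q.1, (1 + u) * q.2).
have lt0 : 0 < lam * t by rewrite mulr_gt0.
have kK u (x : R) : `|u| <= 1 / 2 -> `|x| <= r -> `|(1 + u) * x| <= K.
  move=> hu hx; rewrite normrM; apply: (@le_trans _ _ (2 * r)); last by rewrite /K lerDl.
  apply: ler_pM => //; move: hu; rewrite !ler_norml => /andP[? ?].
  by apply/andP; split; lra.
have k00 u : disp (k u) 0 0 = (1 + u) ^+ 2 * lam.
  by rewrite /disp /= !mulr0 !addr0 !exprMn -mulrDr q2.
have big u (a b : int) : `|u| <= 1 / 2 ->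
    (L%:R < `|a%:~R : R|) || (L%:R < `|b%:~R : R|) -> lam + eta < disp (k u) a b.
  move=> hu hab.
  have hL : lam + eta < 9 * L%:R ^+ 2.
    have : 1 < L%:R :> R by rewrite (lt_trans _ Ll)// ltrDr.
    nra.
  have g (x : R) (c : int) : `|x| <= r -> L%:R < `|c%:~R : R| ->
      9 * L%:R ^+ 2 <= ((1 + u) * x + 2 * pi * c%:~R) ^+ 2.
    move=> hx hc; apply: le_trans _ (wave_ge (kK u x hu hx) (lt_trans LK hc)).
    by rewrite ler_pM2l// -[leRHS]real_normK ?num_real// lerXn2r ?nnegrE// ltW.
  apply: lt_le_trans hL _; rewrite /disp /=; case/orP: hab => hc.
    by rewrite (le_trans (g _ _ qr1 hc))// lerDl sqr_ge0.
  by rewrite (le_trans (g _ _ qr2 hc))// lerDr sqr_ge0.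
have small u (a b : int) : `|u| <= t -> `|a%:~R : R| <= L%:R -> `|b%:~R : R| <= L%:R ->
    `|disp (k u) a b - disp q a b| <= gam / 2.
  move=> hu ha hb; apply: le_trans tD.
  have -> : disp (k u) a b - disp q a b =
      u * ((2 + u) * (q.1 ^+ 2 + q.2 ^+ 2) + 4 * pi * (a%:~R * q.1 + b%:~R * q.2)).
    by rewrite /disp /=; ring.
  rewrite q2 normrM; apply: ler_pM => //; apply: le_trans (ler_normD _ _) _.
  apply: lerD.
    rewrite normrM (gtr0_norm lam0) ler_pM2r//; move: hu; rewrite !ler_norml => /andP[? ?].
    by apply/andP; split; lra.
  rewrite normrM ger0_norm ?mulr_ge0 ?(ltW pi0)//.
  have h1 : `|a%:~R * q.1| <= L%:R * r by rewrite normrM; exact: ler_pM.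
  have h2 : `|b%:~R * q.2| <= L%:R * r by rewrite normrM; exact: ler_pM.
  have h3 := ler_normD (a%:~R * q.1) (b%:~R * q.2).
  rewrite (_ : 8 * pi * L%:R * r = 4 * pi * (L%:R * r + L%:R * r)); last by ring.
  rewrite ler_pM2l ?mulr_gt0//; lra.
have tn : `|- t| <= t by rewrite normrN gtr0_norm.
have tp : `|t| <= t by rewrite gtr0_norm.
have tn' := le_trans tn t1; have tp' := le_trans tp t1.
exists (k (- t)), (k t), eta; split => //; split.
- rewrite k00; nra.
- rewrite k00; nra.
move=> a b ab.
case: (boolP ((L%:R < `|a%:~R : R|) || (L%:R < `|b%:~R : R|))) => hab.
  by right; split; apply: big.
move: hab; rewrite negb_or -!leNgt => /andP[ha hb].
have [i hi] := int_freq ha; have [j hj] := int_freq hb.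
have := hgam (i, j); rewrite /= hi hj -/(disp q a b) => h.
have {}h : gam <= `|disp q a b - lam|.
  apply: h; apply: contra ab => /eqP[ei ej]; move: hi hj; rewrite ei ej /freq /= subrr.
  by move=> /esym/eqP; rewrite intr_eq0 => /eqP -> /esym/eqP; rewrite intr_eq0 => /eqP ->.
exact: gap_same_side gam0 eta2 h (small _ a b tn ha hb) (small _ a b tp ha hb).
Qed.

(** Half of the gap pays for the shift of [lam], so the same segment serves a whole
    neighbourhood. *)
Lemma crossing_near lam lam' eta k0 k1 : crossing lam eta k0 k1 ->
  `|lam - lam'| < eta / 2 -> crossing lam' (eta / 2) k0 k1.
Proof.
move=> [c0 c1 cn]; rewrite ltr_norml => /andP[? ?]; split; [lra|lra|].
move=> a b /cn[[? ?]|[? ?]]; [left|right]; split; lra.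
Qed.

(** The zero mode moves from 0 to [4 lam], while all other modes stay above [(2 pi - 2)^2 >= 4]. The
    gap is proportional to [lam], as is the perturbation [lam * delta], so one [delta] serves all
    small [lam]. *)
Lemma crossing_small lam : 0 < lam -> lam < 1 ->
  crossing lam (lam / 2) (0, 0) (2 * Num.sqrt lam, 0).
Proof.
move=> lam0 lam1; set s := Num.sqrt lam.
have s2 : s ^+ 2 = lam by rewrite sqr_sqrtr// ltW.
have s0 : 0 < s by rewrite sqrtr_gt0.
have s1 : s < 1 by nra.
have pi2 := @pi_ge2 R.
split.
- by rewrite /disp /= !mulr0 !addr0 expr0n /=; lra.
- by rewrite /disp /= !mulr0 !addr0 exprMn s2 expr0n /=; lra.
move=> a b ab; right.
have int1 (c : int) : c != 0 -> (1 <= (c%:~R : R)) \/ (c%:~R <= -1 :> R).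
  case: c => [[//|n]|n] _.
    by left; rewrite -pmulrn ler1n.
  by right; rewrite NegzE mulrNz lerN2 -pmulrn ler1n.
have sq (x : R) (c : int) : 0 <= x -> x <= 2 -> c != 0 ->
    4 <= (x + 2 * pi * c%:~R) ^+ 2.
  move=> x0 x2; have pi0 : 0 <= 2 * pi :> R by rewrite mulr_ge0 ?pi_ge0.
  case/int1 => h; have := ler_wpM2l pi0 h; move: (2 * pi * _) => y hy; nra.
have both (x : R) : 0 <= x -> x <= 2 ->
    4 <= (x + 2 * pi * a%:~R) ^+ 2 + (0 + 2 * pi * b%:~R) ^+ 2.
  move=> x0 x2; have := sqr_ge0 (x + 2 * pi * a%:~R).
  have := sqr_ge0 (0 + 2 * pi * b%:~R : R).
  have [a0|a0] := eqVneq a 0; last by have := sq x a x0 x2 a0; lra.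
  have b0 : b != 0 by apply: contra ab => /eqP ->; rewrite a0.
  by have := sq 0 b (lexx _) (ler0n _ 2) b0; lra.
rewrite /disp /=; split.
  by have := both 0 (lexx _) (ler0n _ 2); lra.
have := both (2 * s) _ _; lra.
Qed.

End ChoiceOfQuasimomenta.

(** * Compactness in the spectral parameter *)

Theorem theorem2p4 (R : realType) (Lambda : R) (Lambda_gt0 : 0 < Lambda) :
  exists delta : R, 0 < delta /\
    forall eps : R * R -> R,
      continuous eps ->
      (forall x : R * R, 0 < eps x) ->
      Z2_periodic eps ->
      (forall x : R * R, `|eps x - 1| < delta) ->
      forall lambda : R, 0 <= lambda -> lambda <= Lambda ->
        exists E : R * R -> R[i]%C,
          [/\ cbounded E, nonzero E & distributional_solution eps lambda E].
Proof.
have veps (eps : R * R -> R) (delta lam : R) : 0 <= lam ->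
    (forall x, `|eps x - 1| < delta) -> forall x, `|lam * eps x - lam| <= lam * delta.
  move=> lam0 heps x; rewrite -{2}[lam]mulr1 -mulrBr normrM ger0_norm//.
  by rewrite ler_wpM2l// ltW.
have /compact_near_coveringP cK := @segment_compact R 0 Lambda.
(* The sign condition sits inside [P] because a neighbourhood of a point of [[0, Lambda]] may
   contain negative numbers. *)
pose P (delta lam : R) := 0 <= lam -> forall eps : R * R -> R,
  continuous eps -> Z2_periodic eps -> (forall x : R * R, `|eps x - 1| < delta) ->
  exists E : R * R -> R[i]%C,
    [/\ cbounded E, nonzero E & distributional_solution eps lam E].
have : \forall delta \near 0^'+, `[0, Lambda]%classic `<=` P delta.
  apply: cK => lam0; rewrite /= in_itv/= => /andP[+ _].
  rewrite le_eqVlt => /predU1P[<-|lam00].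
    near=> lam delta => /= lamge eps ceps peps heps.
    have lam1 : `|0 - lam| < 1 by near: lam; exact: cvgr_dist_lt.
    have d4 : delta < 1 / 4 by near: delta; exact: nbhs_right_lt.
    (* Near 0 the value 0 itself is served by constants and the positive values by the explicit
       crossing. *)
    move: lamge; rewrite le_eqVlt => /predU1P[<-|lamgt].
      exact: constant_solution.
    apply: (crossing_solution ceps peps (veps eps delta lam (ltW lamgt) heps)
      (ltW lamgt) _ (crossing_small lamgt _)).
      nra.
    by move: lam1; rewrite sub0r normrN gtr0_norm.
  have [k0 [k1 [eta [eta0 cr]]]] := crossing_exists lam00.
  have eta2 : 0 < eta / 2 by rewrite divr_gt0.
  (* As [lam < lam0 + eta] near [lam0], a [delta] below this quotient keeps [lam * delta] under the
     halved gap. *)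
  have q0 : 0 < eta / 2 / (lam0 + eta) := divr_gt0 eta2 (addr_gt0 lam00 eta0).
  near=> lam delta => /= lamge eps ceps peps heps.
  have lame : `|lam0 - lam| < eta / 2 by near: lam; exact: cvgr_dist_lt.
  have dq : delta < eta / 2 / (lam0 + eta) by near: delta; exact: nbhs_right_lt.
  have d0 : 0 < delta by near: delta; exact: nbhs_right_gt.
  apply: (crossing_solution ceps peps (veps eps delta lam lamge heps) lamge _
    (crossing_near cr lame)).
  move: dq; rewrite ltr_pdivlMr ?addr_gt0//; apply: le_lt_trans.
  rewrite mulrC ler_pM2l//; move: lame; rewrite ltr_norml => /andP[? ?]; lra.
move=> h; have [delta [d0 hd]] := filter_ex (filterI (nbhs_right_gt (0 : R)) h).
exists delta; split => // eps ceps _ peps heps lambda l0 lL.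
by apply: (hd lambda) => //; rewrite /= in_itv/= l0 lL.
Unshelve. all: by end_near.
Qed.
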